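(* Let $l$ and $m$ be positive integers and $N = m^{l+1}-1$. Let $\overline{{\rm MTD}}_{l,m} \subset \mathbb{P}^N$ be the Zariski closure of the mixture transition distribution model, and let $I \subset \mathbb{C}[p_{i_0 i_1\cdots i_l} : i_0 i_1\cdots i_l \in [m]^{l+1}]$ be its homogeneous prime ideal. Then: (1) The linear span of $\overline{{\rm MTD}}_{l,m}$ in $\mathbb{P}^N$ has dimension $(m-1)(lm-l+1)$. (2) Inside this linear space, the prime ideal of $\overline{{\rm MTD}}_{l,m}$ is given by the $2\times 2$-minors of an $l \times (m-1)^2$-matrix of linear forms; that is, there exist linear forms cutting out the linear span and an $l \times (m-1)^2$-matrix $A$ whose entries are linear forms in the unknowns $p_{i_0 i_1\cdots i_l}$, such that $I$ is generated by these linear forms together with the $2\times 2$-minors of $A$. (3) These linear forms and quadrics (the $2 \times 2$-minors of $A$) can be chosen so that together they form a Gröbner basis of $I$ with respect to some term order.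
   Context: Fix positive integers $l$ and $m$, set $N = m^{l+1}-1$ and $[m]=\{1,\ldots,m\}$. Write $\Delta_k$ for the standard $k$-dimensional probability simplex in $\mathbb{R}^{k+1}$. The simplex $\Delta_N$ has coordinates $p_{i_0 i_1 \cdots i_l}$ indexed by sequences $i_0 i_1\cdots i_l \in [m]^{l+1}$; the same $p_{i_0\cdots i_l}$ serve as homogeneous coordinates on the complex projective space $\mathbb{P}^N$, and $\Delta_N$ is regarded as a subset of $\mathbb{P}^N$ via these coordinates. The model ${\rm MTD}_{l,m}$ is the image of the map $\phi_{l,m} : (\Delta_{m-1})^m \times \Delta_{l-1} \to \Delta_N$ whose input is an $m\times m$ transition matrix $(q_{ij})$ (non-negative entries, each row summing to $1$) together with a probability distribution $\lambda=(\lambda_1,\ldots,\lambda_l)$, and which is given by $$ p_{i_0 i_1 \cdots i_{l-1} i_l} = \frac{1}{m^l} \sum_{j=1}^{l} \lambda_j\, q_{i_{j-1},\, i_l}. $$ $\overline{{\rm MTD}}_{l,m}$ denotes the Zariski closure of ${\rm MTD}_{l,m}$ in $\mathbb{P}^N$; its homogeneous prime ideal consists of all polynomials in the $N+1$ unknowns $p_{i_0\cdots i_l}$ generated by the homogeneous ones vanishing on $\overline{{\rm MTD}}_{l,m}$. *)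

(* Defs.v *)
From HB Require Import structures.
From mathcomp Require Import all_boot all_order all_algebra.
From mathcomp Require Import reals complex mpoly.

Set Implicit Arguments.
Unset Strict Implicit.
Unset Printing Implicit Defensive.

Import Order.TTheory GRing.Theory Num.Theory.
Local Open Scope ring_scope.

(* The projective space P(K^n), of dimension n - 1: its points are the lines of
   K^n, and its linear subspaces are the points contained in a given W, of
   projective dimension \dim W - 1. *)
Definition pspace (K : fieldType) (n : nat) : Type :=
  {V : {vspace 'rV[K]_n} | \dim V == 1%N}.

Definition homogeneous (K : fieldType) (n : nat) (f : {mpoly K[n]}) : Prop :=
  exists d : nat, f \is d.-homog.

(* Only meaningful for homogeneous f, for which it can be tested on any nonzero
   representative of P. *)
Definition vanishes_at (K : fieldType) (n : nat)
    (f : {mpoly K[n]}) (P : pspace K n) : Prop :=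
  forall v : 'rV[K]_n, v \in val P -> f.@[v 0] = 0.

Definition zariski_closed (K : fieldType) (n : nat)
    (Z : pspace K n -> Prop) : Prop :=
  exists F : {mpoly K[n]} -> Prop,
    (forall f, F f -> homogeneous f) /\
    (forall P, Z P <-> forall f, F f -> vanishes_at f P).

Definition zariski_closure (K : fieldType) (n : nat)
    (S : pspace K n -> Prop) (P : pspace K n) : Prop :=
  forall Z : pspace K n -> Prop,
    zariski_closed Z -> (forall Q, S Q -> Z Q) -> Z P.

Definition is_linear_span (K : fieldType) (n : nat)
    (S : pspace K n -> Prop) (W : {vspace 'rV[K]_n}) : Prop :=
  (forall P, S P -> (val P <= W)%VS) /\
  (forall W' : {vspace 'rV[K]_n},
     (forall P, S P -> (val P <= W')%VS) -> (W <= W')%VS).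

Definition ideal_gen (A : comNzRingType) (G : A -> Prop) (f : A) : Prop :=
  exists (k : nat) (c g : 'I_k -> A),
    (forall i, G (g i)) /\ f = \sum_(i < k) c i * g i.

Definition vanishing_ideal (K : fieldType) (n : nat)
    (S : pspace K n -> Prop) : {mpoly K[n]} -> Prop :=
  ideal_gen (fun f => homogeneous f /\ forall P, S P -> vanishes_at f P).

Definition minors2 (A : comNzRingType) (r c : nat) (M : 'M[A]_(r, c)) : seq A :=
  [seq M x.1.1 x.2.1 * M x.1.2 x.2.2 - M x.1.1 x.2.2 * M x.1.2 x.2.1
     | x : ('I_r * 'I_r) * ('I_c * 'I_c)
     in [pred x : ('I_r * 'I_r) * ('I_c * 'I_c) |
           (x.1.1 < x.1.2)%N && (x.2.1 < x.2.2)%N]].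

Definition term_order (n : nat) (le : rel 'X_{1..n}) : Prop :=
  [/\ total le, antisymmetric le, transitive le,
      forall u : 'X_{1..n}, le 0%MM u
    & forall u v w : 'X_{1..n}, le u v -> le (u + w)%MM (v + w)%MM].

(* No u qualifies when f = 0. *)
Definition is_leading_monom (K : fieldType) (n : nat) (le : rel 'X_{1..n})
    (f : {mpoly K[n]}) (u : 'X_{1..n}) : Prop :=
  u \in msupp f /\ {in msupp f, forall v, le v u}.

Definition initial_ideal (K : fieldType) (n : nat) (le : rel 'X_{1..n})
    (G : {mpoly K[n]} -> Prop) : {mpoly K[n]} -> Prop :=
  ideal_gen (fun h =>
    exists f u, [/\ G f, is_leading_monom le f u & h = 'X_[u]]).

Definition groebner_basis (K : fieldType) (n : nat) (le : rel 'X_{1..n})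
    (I : {mpoly K[n]} -> Prop) (G : seq {mpoly K[n]}) : Prop :=
  {in G, forall g, I g} /\
  forall h, initial_ideal le I h <-> initial_ideal le (fun g => g \in G) h.

(* The sequences i_0 i_1 ... i_l; the state j of [m] is the ordinal j - 1. *)
Definition mtd_word (l m : nat) : finType := l.+1.-tuple 'I_m : finType.

(* The coordinate p_w is the one of index enum_rank w; here nvars = N + 1. *)
Definition mtd_nvars (l m : nat) : nat := #|mtd_word l m|.

Definition prob_vec (R : realType) (k : nat) (x : 'rV[R]_k) : Prop :=
  (forall i, 0 <= x 0 i) /\ \sum_i x 0 i = 1.

(* The index j of lambda_j runs over 1, ..., l in the model and is shifted to
   0, ..., l - 1 here, so that i_(j-1) becomes the entry of index j of w. *)
Definition mtd_map (R : realType) (l m : nat)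
    (q : 'M[R]_m) (lambda : 'rV[R]_l) : 'rV[R]_(mtd_nvars l m) :=
  \row_a let w : mtd_word l m := enum_val a in
    (m%:R ^+ l)^-1 *
    \sum_(j < l) lambda 0 j *
                 q (tnth w (widen_ord (leqnSn l) j)) (tnth w ord_max).

Definition MTD (R : realType) (l m : nat)
    (P : pspace R[i] (mtd_nvars l m)) : Prop :=
  exists (q : 'M[R]_m) (lambda : 'rV[R]_l),
    [/\ forall i, prob_vec (row i q), prob_vec lambda
      & val P = <[map_mx (fun x : R => x%:C%C) (mtd_map q lambda)]>%VS].

Definition MTD_closure (R : realType) (l m : nat) :
  pspace R[i] (mtd_nvars l m) -> Prop := zariski_closure (@MTD R l m).

Definition MTD_ideal (R : realType) (l m : nat) :
  {mpoly R[i][mtd_nvars l m]} -> Prop := vanishing_ideal (@MTD_closure R l m).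

(* L consists of linear forms cutting out the linear subspace W, M is a matrix
   of linear forms, and L with the 2x2-minors of M generates the ideal I. *)
Definition determinantal_presentation (K : fieldType) (n r c : nat)
    (W : {vspace 'rV[K]_n}) (I : {mpoly K[n]} -> Prop)
    (L : seq {mpoly K[n]}) (M : 'M[{mpoly K[n]}]_(r, c)) : Prop :=
  [/\ {in L, forall f, f \is 1.-homog},
      forall v : 'rV[K]_n, v \in W <-> {in L, forall f, f.@[v 0] = 0},
      forall i j, M i j \is 1.-homog
    & forall f, I f <-> ideal_gen (fun g => g \in L ++ minors2 M) f].

(* Main.v *)
(* The coordinate of a word w of a model point is z_b + sum_j x_j(w_j, b), where b is the
   last letter of w, x_j(0, b) = 0, and x_j(a, b) = s_j t_ab is a rank one l x (m-1)^2 matrix.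
   Without the rank condition these points form the linear span; its coordinates are the
   p_(0...0b) = z_b and the p_(0..a..0b) = z_b + s_j t_ab with a, b <> 0. The closure of the
   model is thus a cone over a Segre variety, cut out by the 2x2-minors of the matrix of the
   differences p_(0..a..0b) - p_(0...0b).
   For the Groebner property take the graded lexicographic order in which the remaining
   (dependent) variables come first, then the p_(0..a..0b), then the p_(0...0b). A
   unitriangular substitution, which preserves leading monomials, reduces to the toric map
   x_jd |-> s_j t_d, z_b |-> z_b with the dependent variables sent to 0: if no leading monomial
   of a basis element divides u, then u is the least monomial in its fibre, hence does not
   lead a polynomial of the kernel. *)

Require Import Defs.
From HB Require Import structures.
From mathcomp Require Import all_boot all_order all_algebra.
From mathcomp Require Import reals complex mpoly ring.

Import Order.TTheory GRing.Theory Num.Theory.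
Local Open Scope ring_scope.

Set Implicit Arguments.
Unset Strict Implicit.
Unset Printing Implicit Defensive.

(** * Polynomials vanishing on infinite grids *)

Lemma poly_inf_roots_eq0 (K : idomainType) (s : nat -> K) (p : {poly K}) :
  injective s -> (forall k, p.[s k] = 0) -> p = 0.
Proof.
move=> sI ps0; apply/eqP/negPn/negP => p0.
have := max_poly_roots p0 (rs := map s (iota 0 (size p))).
rewrite size_map size_iota ltnn map_inj_in_uniq ?iota_uniq //; last first.
  by move=> ? ? _ _ /sI.
by move=> H; have: false by apply: H => //; apply/allP=> y /mapP[k _ ->]; exact/rootP.
Qed.

Lemma widen_lift_max (n : nat) (i : 'I_n) : widen_ord (leqnSn n) i = lift ord_max i.
Proof. by apply/val_inj; rewrite /= /bump leqNgt ltn_ord. Qed.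

(** A monomial is determined by its last exponent together with the others, so a single term of
    [muni f] contributes. Hence [f] is zero once all coefficients of [muni f] are. *)
Lemma mcoeff_muni (K : nzRingType) (n : nat) (f : {mpoly K[n.+1]}) (u : 'X_{1..n.+1}) :
  ((muni f)`_(u ord_max))@_[multinom u (widen_ord (leqnSn n) i) | i < n] = f@_u.
Proof.
rewrite muniE coef_sum raddf_sum /=.
have E (v : 'X_{1..n.+1}) :
    ((f@_v *: 'X_[[multinom v (widen_ord (leqnSn n) i) | i < n]]
       *: 'X^(v ord_max) : {poly {mpoly K[n]}})`_(u ord_max))@_
       [multinom u (widen_ord (leqnSn n) i) | i < n]
    = f@_v * (v == u)%:R.
  rewrite coefZ coefXn; have [->|vu] := eqVneq v u.
    by rewrite eqxx mulr1 mcoeffZ mcoeffX eqxx.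
  case: eqP => [e|_]; last by rewrite !mulr0 raddf0.
  rewrite mulr1 mcoeffZ mcoeffX; case: eqP => // /mnmP e'.
  case/eqP: vu; apply/mnmP=> i; case: (unliftP ord_max i) => [j ->|->] //.
  by have := e' j; rewrite !mnmE widen_lift_max.
rewrite (eq_bigr _ (fun v _ => E v)); have [uf|/[dup] uf] := boolP (u \in msupp f).
  rewrite (bigD1_seq u) //= ?msupp_uniq // eqxx mulr1 big1 ?addr0 // => v /negbTE ->.
  by rewrite mulr0.
move=> /memN_msupp_eq0 ->; rewrite big_seq big1 // => v vf.
by rewrite (_ : (v == u) = false) ?mulr0 //; apply: contraNF uf => /eqP <-.
Qed.

Lemma meval_muni (K : comNzRingType) (n : nat) (f : {mpoly K[n.+1]}) (v : 'I_n.+1 -> K) :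
  (map_poly (meval (v \o widen_ord (leqnSn n))) (muni f)).[v ord_max] = f.@[v].
Proof.
rewrite muniE mevalE rmorph_sum /= horner_sum; apply: eq_bigr => u _.
rewrite -mul_polyC rmorphM /= map_polyC map_polyXn /= hornerM hornerC hornerXn.
rewrite mevalZ mevalX -mulrA big_ord_recr /=; congr (_ * (_ * _)).
by apply: eq_bigr => i _; rewrite mnmE.
Qed.

(** Induction on [n]: with the other coordinates fixed on the grid, the polynomial in the last
    variable has infinitely many roots, so its coefficients vanish on the smaller grid. Each
    coordinate has its own sequence because the model parameters obey different bounds. *)
Lemma mpoly_grid_eq0 (K : idomainType) (n : nat) (s : 'I_n -> nat -> K)
    (f : {mpoly K[n]}) :
  (forall i, injective (s i)) ->
  (forall k : 'I_n -> nat, f.@[fun i => s i (k i)] = 0) -> f = 0.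
Proof.
elim: n s f => [|n IHn] s f sI f0.
  apply/mpolyP=> u; have -> : u = 0%MM by apply/mnmP; case.
  have := f0 (fun=> 0%N); rewrite (mpolyE f) raddf_sum mcoeff0 raddf_sum /= => e.
  rewrite -[RHS]e; apply: eq_bigr => v _; have -> : v = 0%MM by apply/mnmP; case.
  by rewrite mpolyX0 mevalZ meval1 mcoeffZ mcoeff1 eqxx.
have c0 k : (muni f)`_k = 0.
  apply: (IHn (fun i => s (widen_ord (leqnSn n) i))) => [i|e]; first exact: sI.
  have /(congr1 (fun p : {poly K} => p`_k)) :
      map_poly (meval (fun i => s (widen_ord (leqnSn n) i) (e i))) (muni f) = 0.
    apply: (poly_inf_roots_eq0 (sI ord_max)) => j.
    (* The grid index [e], extended by [j] in the last coordinate. *)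
    pose e' (i : 'I_n.+1) := if unlift ord_max i is Some i' then e i' else j.
    have := f0 e'; rewrite -meval_muni {2}/e' unlift_none => E.
    rewrite -[RHS]E; congr (_.[_]); apply: eq_map_poly => g; apply: meval_eq => i /=.
    by rewrite /e' widen_lift_max liftK.
  by rewrite coef_map coef0.
by apply/mpolyP=> u; rewrite -mcoeff_muni c0 !mcoeff0.
Qed.

(** * Leading monomials for a term order *)

Lemma rmorph_mmap (n : nat) (A : nzRingType) (B C : comNzRingType)
    (f : {rmorphism A -> B}) (g : {rmorphism B -> C}) (h : 'I_n -> B) (p : {mpoly A[n]}) :
  g (mmap f h p) = mmap (g \o f) (g \o h) p.
Proof.
rewrite /mmap rmorph_sum; apply: eq_bigr => u _; rewrite rmorphM; congr (_ * _).
by rewrite /mmap1 rmorph_prod; apply: eq_bigr => i _; rewrite rmorphXn.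
Qed.

Section LeadingMonomials.
Variables (K : fieldType) (n : nat) (le : rel 'X_{1..n}).
Hypothesis leO : term_order le.

Definition below (u : 'X_{1..n}) (f : {mpoly K[n]}) :=
  forall v, v \in msupp f -> le v u /\ v != u.

(** With leading coefficient 1 built in, leads multiply without scalars to track. *)
Definition monic_lead (u : 'X_{1..n}) (f : {mpoly K[n]}) :=
  f@_u = 1 /\ forall v, v \in msupp f -> le v u.

Lemma term_order_refl u : le u u.
Proof. by case: leO => tot _ _ _ _; have := tot u u; rewrite orbb. Qed.

Lemma below0 u : below u 0.
Proof. by move=> v; rewrite msupp0. Qed.

Lemma belowN u f : below u f -> below u (- f).
Proof. by move=> fu v; rewrite (perm_mem (msuppN f)); apply: fu. Qed.

Lemma belowD u f g : below u f -> below u g -> below u (f + g).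
Proof. by move=> fu gu v /msuppD_le; rewrite mem_cat => /orP[/fu|/gu]. Qed.

Lemma belowB u f g : below u f -> below u g -> below u (f - g).
Proof. by move=> fu gu; apply/belowD/belowN. Qed.

Lemma belowX u v : le v u -> v != u -> below u 'X_[v].
Proof. by move=> vu ne w; rewrite msuppX inE => /eqP->. Qed.

Lemma monic_leadX u : monic_lead u 'X_[u].
Proof.
split=> [|v]; first by rewrite mcoeffX eqxx.
by rewrite msuppX inE => /eqP->; apply: term_order_refl.
Qed.

Lemma monic_leadD u f g : monic_lead u f -> below u g -> monic_lead u (f + g).
Proof.
move=> [f1 fu] gu; split=> [|v /msuppD_le].
  by rewrite mcoeffD f1 memN_msupp_eq0 ?addr0 //; apply/negP => /gu[_ /eqP].
by rewrite mem_cat => /orP[/fu|/gu[]].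
Qed.

Lemma monic_leadB u f g : monic_lead u f -> below u g -> monic_lead u (f - g).
Proof. by move=> fu gu; apply/monic_leadD/belowN. Qed.

Lemma monic_lead_below u v f : monic_lead u f -> le u v -> u != v -> below v f.
Proof.
move=> [_ fu] uv ne w /fu wu; case: leO => _ anti tr _ _; split; first exact: tr wu uv.
by apply: contraNneq ne => e; apply/eqP/anti; rewrite uv -e wu.
Qed.

Lemma leading_monom_monic u f : monic_lead u f -> is_leading_monom le f u.
Proof. by case=> f1 fu; split=> //; rewrite mcoeff_msupp f1 oner_neq0. Qed.

Lemma term_order_add u v u' v' : le u u' -> le v v' -> le (u + v)%MM (u' + v')%MM.
Proof.
case: leO => _ _ tr _ add uu' vv'; apply: (tr (u' + v)%MM); first exact: add.
by rewrite ![(u' + _)%MM]addmC; apply: add.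
Qed.

Lemma term_order_add_eq u v u' v' :
  le u u' -> le v v' -> (u + v)%MM = (u' + v')%MM -> u = u' /\ v = v'.
Proof.
case: leO => _ anti tr _ add uu' vv' e.
have uE : u = u'.
  apply: (@addIm _ v); apply: anti; rewrite add //= e.
  by rewrite ![(u' + _)%MM]addmC add.
by split=> //; apply: (@addmI _ u); rewrite e uE.
Qed.

(** By [term_order_add_eq], [u] and [v] form the only pair of support monomials whose exponents add
    up to [u + v], so nothing cancels there. *)
Lemma monic_leadM u v f g :
  monic_lead u f -> monic_lead v g -> monic_lead (u + v)%MM (f * g).
Proof.
move=> [f1 fu] [g1 gv]; split=> [|w /msuppM_le /allpairsP[[a b] /= [/fu ? /gv ? ->]]];
  last exact: term_order_add.
rewrite [f]mpolyE [g]mpolyE big_distrlr /= raddf_sum /=.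
have F (a b : 'X_{1..n}) : (f@_a *: 'X_[a] * (g@_b *: 'X_[b]))@_(u + v)
     = f@_a * g@_b * ((a + b)%MM == (u + v)%MM)%:R.
  by rewrite -scalerAl -scalerAr -mpolyXD !mcoeffZ mcoeffX mulrA.
rewrite (bigD1_seq u) ?msupp_uniq //=; last by rewrite mcoeff_msupp f1 oner_neq0.
rewrite raddf_sum (bigD1_seq v) ?msupp_uniq //=; last by rewrite mcoeff_msupp g1 oner_neq0.
rewrite F eqxx mulr1 big1 ?addr0 => [|b ne].
  rewrite f1 g1 mulr1 big_seq_cond big1 ?addr0 // => a /andP[af ne].
  rewrite raddf_sum big_seq big1 // => b bg.
  rewrite /= F; case: eqP => [e|_]; last by rewrite mulr0.
  by case/eqP: ne; have [] := term_order_add_eq (fu _ af) (gv _ bg) e.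
by rewrite /= F; case: eqP => [/addmI e|_]; rewrite ?mulr0 //; case/eqP: ne.
Qed.

Lemma monic_lead1 : monic_lead 0%MM 1.
Proof. by rewrite -mpolyX0; apply: monic_leadX. Qed.

Lemma monic_lead_mmap1 (h : 'I_n -> {mpoly K[n]}) u :
  (forall i, monic_lead U_(i)%MM (h i)) -> monic_lead u (mmap1 h u).
Proof.
move=> hl; rewrite {1}[u]multinomUE_id /mmap1.
elim/big_rec2: _ => [|i f v _ IH]; first exact: monic_lead1.
apply: monic_leadM IH; elim: (u i) => [|e IHe]; first exact: monic_lead1.
by rewrite exprS mulmS; apply: monic_leadM.
Qed.

(** The image of ['X_[v]] has lead [v], so among the monomials of [f] only [u] contributes to the
    coefficient at [u]. *)
Lemma leading_monom_mmap (h : 'I_n -> {mpoly K[n]}) u f :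
  (forall i, monic_lead U_(i)%MM (h i)) ->
  is_leading_monom le f u -> is_leading_monom le (mmap (@mpolyC n K) h f) u.
Proof.
move=> hl [uf fu]; have hl1 := fun v => monic_lead_mmap1 v hl.
have ub v : v \in msupp (mmap (@mpolyC n K) h f) -> le v u.
  case: (leO) => _ _ tr _ _.
  rewrite /mmap => /msupp_sum_le /flattenP[s /mapP[w]]; rewrite mem_filter /= => wf ->.
  by rewrite mul_mpolyC => /msuppZ_le /(proj2 (hl1 w)) vw; apply: tr vw (fu _ wf).
split=> //; rewrite mcoeff_msupp /mmap raddf_sum (bigD1_seq u) ?msupp_uniq //=.
rewrite mcoeffCM (proj1 (hl1 u)) mulr1 big_seq_cond big1 ?addr0 -?mcoeff_msupp // => v /andP[vf ne].
rewrite mcoeffCM (@memN_msupp_eq0 _ _ (mmap1 h v)) ?mulr0 //; apply/negP => /(proj2 (hl1 v)) uv.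
by case: leO => _ anti _ _ _; case/eqP: ne; apply: anti; rewrite uv fu.
Qed.

Lemma leading_monom_exists (f : {mpoly K[n]}) : f != 0 -> exists u, is_leading_monom le f u.
Proof.
case: leO => tot _ tr _ _; rewrite -msupp_eq0 /is_leading_monom.
elim: (msupp f) => // u s IHs _; case: (altP (s =P [::])) => [->|/IHs[v [vs sv]]].
  by exists u; split=> [|w]; rewrite inE ?eqxx // => /eqP->; apply: term_order_refl.
have [uv|vu] := orP (tot u v).
  by exists v; split=> [|w]; rewrite inE ?vs ?orbT // => /orP[/eqP->//|/sv].
exists u; split=> [|w]; rewrite inE ?eqxx // => /orP[/eqP->|/sv wv].
  exact: term_order_refl.
exact: tr wv vu.
Qed.

(** * Gröbner bases from divisibility of leading monomials *)

Section Groebner.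
Variables (I : {mpoly K[n]} -> Prop) (G : seq {mpoly K[n]}).
Hypothesis IB : forall f g, I f -> I g -> I (f - g).
Hypothesis IM : forall f g, I g -> I (f * g).
Hypothesis GI : {in G, forall g, I g}.
Hypothesis lead_dvd : forall f u, I f -> is_leading_monom le f u ->
  exists2 g, g \in G & exists2 v, monic_lead v g & (v <= u)%MM.

Lemma groebner_basis_of_leads : groebner_basis le I G.
Proof.
split=> // h; split=> -[k [c [g [gG ->]]]].
  (* Each term is rewritten with the leading monomial of a member of [G]; the quotient ['X_[u - v]]
     moves into the coefficient. *)
  pose P (i : 'I_k) (cg : {mpoly K[n]} * {mpoly K[n]}) := c i * g i = cg.1 * cg.2 /\
    exists f u, [/\ f \in G, is_leading_monom le f u & cg.2 = 'X_[u]].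
  have /fin_all_exists[cg cgP] : forall i : 'I_k, exists cg, P i cg.
    rewrite /P => i; have [f [u [/lead_dvd fI /fI[g' gG' [v g'v vu]] ->]]] := gG i.
    exists (c i * 'X_[u - v], 'X_[v]); rewrite /= -mulrA -mpolyXD submK //; split=> //.
    by exists g', v; split=> //; apply: leading_monom_monic.
  exists k, (fun i => (cg i).1), (fun i => (cg i).2); split=> [i|]; first exact: (proj2 (cgP i)).
  by apply: eq_bigr => i _; case: (cgP i).
exists k, c, g; split=> // i; have [f [u [/GI ? ? ?]]] := gG i.
by exists f, u.
Qed.

Hypothesis le_wf : well_founded (fun u v => le u v && (u != v)).

(** Division algorithm: subtracting a multiple of a member of [G] cancels the lead, the remainder
    stays in [I] with a smaller lead, and well-foundedness ends the process. *)
Lemma ideal_gen_of_leads f : I f -> ideal_gen (fun g => g \in G) f.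
Proof.
have cons (p g f' : {mpoly K[n]}) : g \in G -> ideal_gen (fun g => g \in G) f' ->
    ideal_gen (fun g => g \in G) (p * g + f').
  move=> gG [k [c [b [bG ->]]]].
  exists k.+1, (fun i => oapp c p (unlift ord0 i)), (fun i => oapp b g (unlift ord0 i)).
  split=> [i|]; first by case: (unlift ord0 i) => [j|]; rewrite /= ?gG; first exact: bG.
  rewrite big_ord_recl /= unlift_none /=; congr (_ + _); apply: eq_bigr => i _.
  by rewrite liftK.
have nil : ideal_gen (fun g => g \in G) 0.
  exists 0%N, (fun=> 0), (fun=> 0); split=> [[]//|]; by rewrite big_ord0.
have [->//|f0 fI] := eqVneq f 0.
have [u] := leading_monom_exists f0; elim: u / (le_wf u) f f0 fI => u _ IH f f0 fI fu.
have [g gG [v gv vu]] := lead_dvd fI fu.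
(* No division by a leading coefficient occurs, since that of [g] is 1. *)
pose p := f@_u *: 'X_[u - v]; rewrite -[f](addrNK (p * g)) addrC; apply: cons => //.
set f' := f - p * g; have f'I : I f' by apply/IB/IM/GI.
have [->//|f'0] := eqVneq f' 0; have [w f'w] := leading_monom_exists f'0.
apply: (IH w) => //.
have [pg1 pgu] : monic_lead u ('X_[u - v] * g).
  by rewrite -{1}(submK vu); apply: monic_leadM => //; apply: monic_leadX.
apply/andP; split.
  have := proj1 f'w; rewrite /f' => /msuppB_le; rewrite mem_cat => /orP[/(proj2 fu)//|].
  by rewrite /p -scalerAl => /msuppZ_le /pgu.
apply: contraTneq (proj1 f'w) => ->.
by rewrite mcoeff_msupp /f' /p -scalerAl mcoeffB mcoeffZ pg1 mulr1 subrr eqxx.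
Qed.

End Groebner.
End LeadingMonomials.

(** * The toric ideal of the Segre cone *)

Section KeyOrder.
Variables (n N : nat) (key : 'I_n -> 'I_N).
Hypothesis key_inj : injective key.

(** Renaming the variables along [key] pulls back the graded lexicographic order, in which lower
    indices weigh more: a smaller key makes a larger variable. *)
Definition key_mnm (u : 'X_{1..n}) : 'X_{1..N} :=
  [multinom (\sum_(i | key i == j) u i)%N | j < N].

Definition key_le : rel 'X_{1..n} := fun u v => (key_mnm u <= key_mnm v)%O.

Lemma key_mnmE u i : key_mnm u (key i) = u i.
Proof. by rewrite mnmE (big_pred1 i) // => j; rewrite (inj_eq key_inj). Qed.

Lemma key_mnm_inj : injective key_mnm.
Proof. by move=> u v e; apply/mnmP=> i; rewrite -!key_mnmE e. Qed.

Lemma key_mnmD u v : key_mnm (u + v)%MM = (key_mnm u + key_mnm v)%MM.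
Proof.
by apply/mnmP=> j; rewrite mnmDE !mnmE -big_split; apply: eq_bigr => i _; rewrite mnmDE.
Qed.

Lemma mdeg_key_mnm u : mdeg (key_mnm u) = mdeg u.
Proof.
rewrite !mdegE [RHS](partition_big key xpredT) //=.
by apply: eq_bigr => j _; rewrite mnmE.
Qed.

Lemma key_le_term_order : term_order key_le.
Proof.
split=> [u v|u v|v u w|u|u v w]; rewrite /key_le.
- exact: le_total.
- by move=> /le_anti/key_mnm_inj.
- exact: le_trans.
- suff -> : key_mnm 0%MM = 0%MM by apply: le0x.
  by apply/mnmP=> j; rewrite mnm0E mnmE big1 // => i _; rewrite mnm0E.
- by rewrite !key_mnmD lemc_add2l.
Qed.

Lemma key_le_wf : well_founded (fun u v => key_le u v && (u != v)).
Proof.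
have H v u : key_mnm u = v -> Acc (fun u v => key_le u v && (u != v)) u.
  elim/(well_founded_ind (@ltom_wf N)): v u => v IH u e; constructor=> w /andP[wu ne].
  by apply: IH (erefl _); rewrite -e lt_neqAle (inj_eq key_mnm_inj) ne.
by move=> u; apply: H.
Qed.

Lemma key_lt u v i : mdeg u = mdeg v -> (u i < v i)%N ->
  (forall j, (key j < key i)%N -> u j = v j) -> key_le u v /\ u != v.
Proof.
move=> e lti eqi; have : (key_mnm u < key_mnm v)%O.
  apply/ltmcP; rewrite ?mdeg_key_mnm //; exists (key i); last by rewrite !key_mnmE.
  by move=> j lt; rewrite !mnmE; apply: eq_bigr => p /eqP pj; apply: eqi; rewrite pj.
by rewrite lt_neqAle (inj_eq key_mnm_inj) => /andP[].
Qed.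

Lemma key_ltU i j : (key j < key i)%N -> key_le U_(i)%MM U_(j)%MM /\ (U_(i) != U_(j))%MM.
Proof.
move=> ji; have ne : (i == j) = false by apply: contraTF ji => /eqP->; rewrite ltnn.
apply: (@key_lt _ _ j); rewrite ?mdeg1 // ?mnm1E ?eqxx ?ne // => p pj.
rewrite !mnm1E; case: eqP => [e|_]; first by move: pj; rewrite -e ltnNge ltnW.
by case: eqP pj => // ->; rewrite ltnn.
Qed.

Lemma key_leNge u v : mdeg u = mdeg v -> ~~ key_le u v ->
  exists2 i, (v i < u i)%N & forall j, (key j < key i)%N -> v j = u j.
Proof.
move=> e; rewrite /key_le -ltNge => /ltmcP; rewrite !mdeg_key_mnm => /(_ (esym e)) [i' eqi lti].
have [i ei] : exists i, key i = i'.
  (* Outside the image of [key] both renamed exponents are empty sums, so the first difference lies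
     in the image. *)
  suff: [exists i, key i == i'] by move=> /existsP[i /eqP]; exists i.
  apply: contraTT lti => /existsPn ne; rewrite !mnmE !big_pred0 // => i; exact/negbTE.
subst i'; exists i => [|j /eqi]; first by move: lti; rewrite !key_mnmE.
by rewrite !key_mnmE.
Qed.

End KeyOrder.

(* If [u] and [v] first differ at (j0, d0), compare the column sums over d <= d0: the
   chain condition forces all of the mass of [u] in the rows below j0 into these columns. *)
Lemma chain_margins_lexmin (l c : nat) (u v : 'I_l -> 'I_c -> nat) (j0 : 'I_l) (d0 : 'I_c) :
  (forall j, \sum_d u j d = \sum_d v j d)%N ->
  (forall d, \sum_j u j d = \sum_j v j d)%N ->
  (forall (j j' : 'I_l) (d d' : 'I_c), (j < j')%N -> (d < d')%N -> u j d = 0%N \/ u j' d' = 0%N) ->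
  (forall (j : 'I_l) (d : 'I_c), (j < j0)%N \/ j = j0 /\ (d < d0)%N -> v j d = u j d) ->
  (u j0 d0 <= v j0 d0)%N.
Proof.
move=> rowE colE chain pre; rewrite leqNgt; apply/negP => lt0.
(* The mass in the columns up to [d0], split into the rows up to [j0] and the later ones. The total
   is fixed by the column sums, but [T] is strictly larger for [u] than for [v] and [S] is at least
   as large. *)
pose T (w : 'I_l -> 'I_c -> nat) := (\sum_(d < c | d <= d0) \sum_(j < l | j <= j0) w j d)%N.
pose S (w : 'I_l -> 'I_c -> nat) := (\sum_(d < c | d <= d0) \sum_(j < l | ~~ (j <= j0)) w j d)%N.
have TS w : (T w + S w = \sum_(d < c | d <= d0) \sum_j w j d)%N.
  rewrite /T /S -big_split; apply: eq_bigr => d _.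
  by rewrite [RHS](bigID (fun j : 'I_l => j <= j0)%N).
have eTS : (T u + S u = T v + S v)%N by rewrite !TS; apply: eq_bigr => d _.
have leuv (j : 'I_l) (d : 'I_c) : (d <= d0)%N -> (j <= j0)%N -> (v j d <= u j d)%N.
  move=> dd jj; have [->|nd] := eqVneq d d0; have [->|nj] := eqVneq j j0; first exact: ltnW.
  - by rewrite pre //; left; rewrite ltn_neqAle nj.
  - by rewrite pre //; right; rewrite ltn_neqAle nd.
  - by rewrite pre //; left; rewrite ltn_neqAle nj.
have ltT : (T v < T u)%N.
  rewrite /T (bigD1 d0) //= [X in (_ < X)%N](bigD1 d0) //= -addSn leq_add //.
    rewrite (bigD1 j0) //= [X in (_ < X)%N](bigD1 j0) //= -addSn leq_add //.
    by apply: leq_sum => j /andP[jj _]; apply: leuv.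
  by apply: leq_sum => d /andP[dd _]; apply: leq_sum => j jj; apply: leuv.
have leS : (S v <= S u)%N.
  rewrite /S exchange_big [X in (_ <= X)%N]exchange_big /=; apply: leq_sum => j.
  rewrite -ltnNge => jj; have -> : (\sum_(d < c | d <= d0) u j d = \sum_d u j d)%N.
    rewrite [RHS](bigID (fun d : 'I_c => d <= d0)%N) /= [X in (_ + X)%N]big1 ?addn0 // => d.
    by rewrite -ltnNge => dd; have [e|//] := chain _ _ _ _ jj dd; rewrite e in lt0.
  by rewrite rowE [X in (_ <= X)%N](bigID (fun d : 'I_c => d <= d0)%N) leq_addr.
by have := leq_add ltT leS; rewrite addSn -eTS ltnn.
Qed.

(** * The toric map and the least monomials of its fibres *)

Section Toric.
Variables (K : fieldType) (n l c k : nat).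
Variables (x : 'I_l -> 'I_c -> 'I_n) (z : 'I_k -> 'I_n).
Hypothesis x_inj : forall j d j' d', x j d = x j' d' -> j = j' /\ d = d'.
Hypothesis z_inj : injective z.
Hypothesis xz : forall j d b, x j d <> z b.

Definition dependent (i : 'I_n) := (forall j d, x j d <> i) /\ (forall b, z b <> i).

(** Placed in [Type] so that functions such as [nat_key] and [toric_point] can branch on it. *)
Variant var_spec (i : 'I_n) : Type :=
  | VarX j d of x j d = i
  | VarZ b of z b = i
  | VarDep of dependent i.

Lemma varP i : var_spec i.
Proof.
case: (pickP (fun p : 'I_l * 'I_c => x p.1 p.2 == i)) => [p /eqP|nx]; first exact: VarX.
case: (pickP (fun b => z b == i)) => [b /eqP|nz]; first exact: VarZ.
apply: VarDep; split=> [j d e|b e]; first by have /eqP := nx (j, d).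
by have /eqP := nz b.
Qed.

(** Three disjoint blocks: the dependent variables below [n], then the [x] in row-major order, then
    the [z]. *)
Definition nat_key (i : 'I_n) : nat :=
  match varP i with
  | VarX j d _ => n + (j * c + d)
  | VarZ b _ => n + l * c + b
  | VarDep _ => i
  end.

Lemma nat_keyX j d : nat_key (x j d) = (n + (j * c + d))%N.
Proof.
by rewrite /nat_key; case: varP => [j' d' /x_inj[-> ->]|b /esym/xz|[/(_ j d)]].
Qed.

Lemma nat_keyZ b : nat_key (z b) = (n + l * c + b)%N.
Proof. by rewrite /nat_key; case: varP => [j d /xz|b' /z_inj->|[_ /(_ b)]]. Qed.

Lemma nat_key_dep i : dependent i -> nat_key i = i.
Proof. by case=> nx nz; rewrite /nat_key; case: varP => [j d /nx|b /nz|]. Qed.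

Lemma mat_index_lt (j : 'I_l) (d : 'I_c) : (j * c + d < l * c)%N.
Proof.
apply: (@leq_trans (j.+1 * c)); last by rewrite leq_mul2r ltn_ord orbT.
by rewrite mulSn addnC ltn_add2r.
Qed.

Lemma nat_key_lt i : (nat_key i < n + l * c + k)%N.
Proof.
rewrite /nat_key; case: varP => [j d _|b _|_].
- by rewrite -addnA ltn_add2l ltn_addr ?mat_index_lt.
- by rewrite ltn_add2l.
- by rewrite -addnA ltn_addr.
Qed.

Definition key i := Ordinal (nat_key_lt i).

Lemma mat_index_inj (j j' : 'I_l) (d d' : 'I_c) :
  (j * c + d = j' * c + d')%N -> j = j' /\ d = d'.
Proof.
have c0 : (0 < c)%N by apply: leq_ltn_trans (ltn_ord d).
move=> e; split; apply/val_inj => /=.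
  by have := congr1 (divn^~ c) e; rewrite /= !divnMDl // !divn_small // !addn0.
by have := congr1 (modn^~ c) e; rewrite /= !modnMDl !modn_small.
Qed.

Lemma key_inj : injective key.
Proof.
move=> i i' [].
case: (varP i) => [j d <-|b <-|iD]; case: (varP i') => [j' d' <-|b' <-|iD'];
  rewrite ?nat_keyX ?nat_keyZ ?(nat_key_dep iD) ?(nat_key_dep iD').
- by move=> /addnI/mat_index_inj[-> ->].
- by rewrite -addnA => /addnI e; have := mat_index_lt j d; rewrite e -ltn_subRL subnn.
- by move=> e; have := ltn_ord i'; rewrite -e -ltn_subRL subnn.
- by rewrite -addnA => /addnI e; have := mat_index_lt j' d'; rewrite -e -ltn_subRL subnn.
- by move=> /addnI/val_inj ->.
- by move=> e; have := ltn_ord i'; rewrite -e -addnA -ltn_subRL subnn.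
- by move=> e; have := ltn_ord i; rewrite e -ltn_subRL subnn.
- by move=> e; have := ltn_ord i; rewrite e -addnA -ltn_subRL subnn.
- by move/val_inj.
Qed.

Definition tle := key_le key.

Lemma tle_term_order : term_order tle.
Proof. exact/key_le_term_order/key_inj. Qed.

Lemma tle_xz j d b : tle U_(z b)%MM U_(x j d)%MM /\ (U_(z b) != U_(x j d))%MM.
Proof.
apply: (key_ltU key_inj); rewrite /= nat_keyX nat_keyZ -addnA ltn_add2l.
by rewrite ltn_addr ?mat_index_lt.
Qed.

Lemma tle_dep_x i j d : dependent i ->
  tle U_(x j d)%MM U_(i)%MM /\ (U_(x j d) != U_(i))%MM.
Proof. by move=> iD; apply: (key_ltU key_inj); rewrite /= nat_keyX nat_key_dep // ltn_addr. Qed.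

Lemma tle_dep_z i b : dependent i -> tle U_(z b)%MM U_(i)%MM /\ (U_(z b) != U_(i))%MM.
Proof.
by move=> iD; apply: (key_ltU key_inj); rewrite /= nat_keyZ nat_key_dep // -addnA ltn_addr.
Qed.

(** Among the four variables [x j d] has the smallest key, hence is the largest, and it occurs only
    in the diagonal product. This makes the diagonal term of each minor the leading one. *)
Lemma tle_diag (j j' : 'I_l) (d d' : 'I_c) : (j < j')%N -> (d < d')%N ->
  tle (U_(x j d') + U_(x j' d))%MM (U_(x j d) + U_(x j' d'))%MM /\
  (U_(x j d') + U_(x j' d) != U_(x j d) + U_(x j' d'))%MM.
Proof.
move=> jj dd.
have E (p q : 'I_n) : (nat_key p < nat_key q)%N -> (q == p) = false.
  by move=> h; apply: contraTF h => /eqP->; rewrite ltnn.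
have k1 : (nat_key (x j d) < nat_key (x j d'))%N by rewrite !nat_keyX !ltn_add2l.
have jc : (j * c + c <= j' * c)%N by rewrite addnC -mulSn leq_mul2r jj orbT.
have k2 : (nat_key (x j d) < nat_key (x j' d))%N.
  by rewrite !nat_keyX ltn_add2l ltn_add2r (leq_trans _ jc) // -addn1 leq_add2l
             (leq_ltn_trans _ (ltn_ord d)).
have k3 : (nat_key (x j d) < nat_key (x j' d'))%N.
  by apply: ltn_trans k2 _; rewrite !nat_keyX !ltn_add2l.
apply: (@key_lt _ _ _ key_inj _ _ (x j d)); first by rewrite !mdegD !mdeg1.
  by rewrite !mnmDE !mnm1E (E _ _ k1) (E _ _ k2) eqxx.
move=> i /= ki; have ki' p : (nat_key (x j d) < nat_key p)%N -> (p == i) = false.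
  by move=> h; apply: E; apply: ltn_trans ki h.
by rewrite !mnmDE !mnm1E (E _ _ ki) !ki'.
Qed.

Lemma sum_nondependent (u : 'X_{1..n}) : (forall i, dependent i -> u i = 0%N) ->
  mdeg u = (\sum_j \sum_d u (x j d) + \sum_b u (z b))%N.
Proof.
move=> uD.
have -> : (\sum_b u (z b) = \sum_i \sum_b (z b == i) * u i)%N.
  rewrite [RHS]exchange_big; apply: eq_bigr => b _.
  rewrite (bigD1 (z b)) //= eqxx mul1n big1 ?addn0 // => i.
  by rewrite eq_sym => /negbTE->.
have -> : (\sum_j \sum_d u (x j d) = \sum_i \sum_j \sum_d (x j d == i) * u i)%N.
  rewrite [RHS]exchange_big; apply: eq_bigr => j _.
  rewrite [RHS]exchange_big; apply: eq_bigr => d _.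
  rewrite (bigD1 (x j d)) //= eqxx mul1n big1 ?addn0 // => i.
  by rewrite eq_sym => /negbTE->.
rewrite mdegE -big_split; apply: eq_bigr => i _ /=.
case: (varP i) => [j d <-|b <-|/[dup] iD /uD ->].
- rewrite (bigD1 j) //= (bigD1 d) //= eqxx mul1n !big1 ?addn0 // => [b _|j' ne|d' ne].
  + by case: eqP => // /esym/xz.
  + by rewrite big1 // => d' _; case: eqP => // /x_inj[e]; rewrite e eqxx in ne.
  + by case: eqP => // /x_inj[_ e]; rewrite e eqxx in ne.
- rewrite (bigD1 b) //= eqxx mul1n big1 => [|j _].
    rewrite add0n big1 ?addn0 // => b' ne.
    by case: eqP => // /z_inj e; rewrite e eqxx in ne.
  by rewrite big1 // => d _; case: eqP => // /xz.
- by rewrite !big1 // => [b _|j _]; rewrite ?big1 // => *; rewrite muln0.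
Qed.

(** Equal margins mean equal toric images, so [u] is least in its fibre. At the first difference in
    key order, a dependent variable or a [z] is excluded by the equalities, and an [x] by
    [chain_margins_lexmin], whose prefix condition is the row-major order of the keys. *)
Lemma tle_min (u v : 'X_{1..n}) :
  (forall i, dependent i -> u i = 0%N) -> (forall i, dependent i -> v i = 0%N) ->
  (forall j, \sum_d u (x j d) = \sum_d v (x j d))%N ->
  (forall d, \sum_j u (x j d) = \sum_j v (x j d))%N ->
  (forall b, u (z b) = v (z b)) ->
  (forall (j j' : 'I_l) (d d' : 'I_c), (j < j')%N -> (d < d')%N -> u (x j d) = 0%N \/ u (x j' d') = 0%N) ->
  tle u v.
Proof.
move=> uD vD rowE colE zE chain.
have dE : mdeg u = mdeg v.
  rewrite !sum_nondependent //; congr (_ + _)%N; apply: eq_bigr => ? _ //.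
apply/contraT => nle; have [ i ] := key_leNge key_inj dE nle; case: (varP i) => [j0 d0 <-|b <-|/uD -> //].
  move=> lt0 pre; have := @chain_margins_lexmin _ _ (fun j d => u (x j d))
    (fun j d => v (x j d)) j0 d0 rowE colE chain; rewrite leqNgt lt0 => H.
  have: false; last by []. apply: H => j d pos; apply: pre; rewrite /= !nat_keyX ltn_add2l.
  case: pos => [lt|[-> ?]]; last by rewrite ltn_add2l.
  apply: (@leq_trans (j.+1 * c)); first by rewrite mulSn addnC ltn_add2r.
  by apply: leq_trans (leq_addr _ _); rewrite leq_mul2r lt orbT.
by rewrite zE ltnn.
Qed.

Definition s_var (j : 'I_l) : 'I_(l + (c + k)) := lshift _ j.
Definition t_var (d : 'I_c) : 'I_(l + (c + k)) := rshift l (lshift k d).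
Definition y_var (b : 'I_k) : 'I_(l + (c + k)) := rshift l (rshift c b).

Definition toric_point (i : 'I_n) : {mpoly K[l + (c + k)]} :=
  match varP i with
  | VarX j d _ => 'X_(s_var j) * 'X_(t_var d)
  | VarZ b _ => 'X_(y_var b)
  | VarDep _ => 0
  end.

Lemma toric_pointX j d : toric_point (x j d) = 'X_(s_var j) * 'X_(t_var d).
Proof.
by rewrite /toric_point; case: varP => [j' d' /x_inj[-> ->]|b /esym/xz|[/(_ j d)]].
Qed.

Lemma toric_pointZ b : toric_point (z b) = 'X_(y_var b).
Proof. by rewrite /toric_point; case: varP => [j d /xz|b' /z_inj->|[_ /(_ b)]]. Qed.

Lemma toric_point_dep i : dependent i -> toric_point i = 0.
Proof. by case=> nx nz; rewrite /toric_point; case: varP => [j d /nx|b /nz|]. Qed.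

(** The exponent vector of the toric image of ['X_[u]] when [u] avoids the dependent variables: row
    sums for [s], column sums for [t]. *)
Definition margins (u : 'X_{1..n}) : 'X_{1..l + (c + k)} :=
  [multinom match split i with
            | inl j => \sum_d u (x j d)
            | inr i' => match split i' with
                        | inl d => \sum_j u (x j d)
                        | inr b => u (z b)
                        end
            end%N | i < l + (c + k)].

Lemma margins_s u j : margins u (s_var j) = (\sum_d u (x j d))%N.
Proof. by rewrite mnmE (unsplitK (inl j)). Qed.

Lemma margins_t u d : margins u (t_var d) = (\sum_j u (x j d))%N.
Proof. by rewrite mnmE (unsplitK (inr (lshift k d))) (unsplitK (inl d)). Qed.

Lemma margins_y u b : margins u (y_var b) = u (z b).
Proof. by rewrite mnmE (unsplitK (inr (rshift c b))) (unsplitK (inr b)). Qed.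

Lemma margins0 : margins 0%MM = 0%MM.
Proof.
apply/mnmP=> i; rewrite !mnmE; case: splitP => [j _|i' _].
  by rewrite big1 // => d _; rewrite mnmE.
case: splitP => [d _|b _]; last by rewrite mnmE.
by rewrite big1 // => d' _; rewrite mnmE.
Qed.

Lemma marginsD u v : margins (u + v)%MM = (margins u + margins v)%MM.
Proof.
apply/mnmP=> i; rewrite !mnmE; case: splitP => [j _|i' _].
  by rewrite -big_split; apply: eq_bigr => d _; rewrite mnmE.
case: splitP => [d _|b _]; last by rewrite mnmE.
by rewrite -big_split; apply: eq_bigr => d' _; rewrite mnmE.
Qed.

Lemma toric_pointE i : ~ dependent i -> toric_point i = 'X_[margins U_(i)].
Proof.
case: (varP i) => [j d <- _|b <- _|//].
  rewrite toric_pointX -mpolyXD; congr 'X_[_]; apply/mnmP=> p; rewrite mnmDE !mnm1E.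
  rewrite -(splitK p); case: (split p) => [j'|p'] /=; rewrite -/(s_var _).
    rewrite margins_s eq_lshift eq_rlshift addn0.
    rewrite (bigD1 d) //= big1 ?addn0 => [|d' ne]; rewrite mnm1E.
      by case: (eqVneq j j') => [->|ne]; rewrite ?eqxx //; case: eqP => // /x_inj[e]; rewrite e eqxx in ne.
    by case: eqP => // /x_inj[_ e]; rewrite e eqxx in ne.
  rewrite -(splitK p'); case: (split p') => [d'|b] /=.
    rewrite -/(t_var d') margins_t eq_lrshift add0n eq_rshift eq_lshift.
    rewrite (bigD1 j) //= big1 ?addn0 => [|j' ne]; rewrite mnm1E.
      by case: (eqVneq d d') => [->|ne]; rewrite ?eqxx //; case: eqP => // /x_inj[_ e]; rewrite e eqxx in ne.
    by case: eqP => // /x_inj[e]; rewrite e eqxx in ne.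
  rewrite -/(y_var b) margins_y eq_lrshift eq_rshift eq_lrshift mnm1E.
  by case: eqP => // /xz.
rewrite toric_pointZ; congr 'X_[_]; apply/mnmP=> p; rewrite !mnm1E.
rewrite -(splitK p); case: (split p) => [j'|p'] /=.
  rewrite -/(s_var _) margins_s eq_rlshift big1 // => d _.
  by rewrite mnm1E; case: eqP => // /esym/xz.
rewrite -(splitK p'); case: (split p') => [d'|b'] /=.
  rewrite -/(t_var d') margins_t eq_rshift eq_rlshift big1 // => d _.
  by rewrite mnm1E; case: eqP => // /esym/xz.
by rewrite -/(y_var b') margins_y !eq_rshift mnm1E (inj_eq z_inj).
Qed.

Lemma toric_mmap1_dep (u : 'X_{1..n}) i : dependent i -> u i != 0%N -> mmap1 toric_point u = 0.
Proof. by move=> iD ui; rewrite /mmap1 (bigD1 i) //= toric_point_dep // expr0n (negbTE ui) mul0r. Qed.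

Lemma toric_mmap1 (u : 'X_{1..n}) :
  (forall i, dependent i -> u i = 0%N) -> mmap1 toric_point u = 'X_[margins u].
Proof.
move=> uD; rewrite {2}[u]multinomUE_id (big_morph margins marginsD margins0).
rewrite (big_morph _ (@mpolyXD _ K) (@mpolyX0 _ K)) /mmap1.
apply: eq_bigr => i _; case: (varP i) => [j d e|b e|/uD ->].
- elim: (u i) => [|m IHm]; first by rewrite expr0 mulm0n margins0 mpolyX0.
  rewrite exprS IHm mulmS marginsD mpolyXD toric_pointE // -e => -[/(_ j d)]; exact.
- elim: (u i) => [|m IHm]; first by rewrite expr0 mulm0n margins0 mpolyX0.
  rewrite exprS IHm mulmS marginsD mpolyXD toric_pointE // -e => -[_ /(_ b)]; exact.
- by rewrite expr0 mulm0n margins0 mpolyX0.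
Qed.

(** As [dependent] is a proposition, the case distinction goes through a boolean read off from
    [varP]. *)
Lemma dependent_support (u : 'X_{1..n}) :
  (exists2 i, dependent i & u i != 0%N) \/ (forall i, dependent i -> u i = 0%N).
Proof.
pose dep i := if varP i is VarDep _ then true else false.
have depP i : dependent i -> dep i.
  by case=> nx nz; rewrite /dep; case: varP => // [j d /nx|b /nz].
have [/existsP[i /andP[ui di]]|/existsPn nD] := boolP [exists i, (u i != 0%N) && dep i].
  by left; exists i => //; move: di; rewrite /dep; case: varP.
by right=> i /depP di; apply/eqP; have := nD i; rewrite di andbT negbK.
Qed.

(** The two alternatives are divisibility of [u] by the lead of a linear form and by the lead of a
    minor. *)
Lemma toric_lead (f : {mpoly K[n]}) u :
  is_leading_monom tle f u -> mmap (@mpolyC _ K) toric_point f = 0 ->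
  (exists2 i, dependent i & u i != 0%N) \/
  exists (j j' : 'I_l) (d d' : 'I_c),
    [/\ (j < j')%N, (d < d')%N, u (x j d) != 0%N & u (x j' d') != 0%N].
Proof.
move=> [uf fu] f0; have [|uD] := dependent_support u; [by left|right].
pose bad (p : ('I_l * 'I_l) * ('I_c * 'I_c)) := [&& (p.1.1 < p.1.2)%N, (p.2.1 < p.2.2)%N,
  u (x p.1.1 p.2.1) != 0%N & u (x p.1.2 p.2.2) != 0%N].
have [/existsP[p /and4P[? ? ? ?]]|/existsPn ok] := boolP [exists p, bad p].
  by exists p.1.1, p.1.2, p.2.1, p.2.2.
have chain (j j' : 'I_l) (d d' : 'I_c) :
    (j < j')%N -> (d < d')%N -> u (x j d) = 0%N \/ u (x j' d') = 0%N.
  move=> jj dd; have := ok ((j, j'), (d, d')); rewrite /bad /= jj dd /= negb_and !negbK.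
  by case/orP=> /eqP; [left|right].
(* [u] is minimal among the monomials with its toric image, so that its coefficient
   cannot cancel. *)
exfalso; have := congr1 (mcoeff (margins u)) f0.
rewrite mcoeff0 /mmap raddf_sum /= (bigD1_seq u) ?msupp_uniq //=.
rewrite mcoeffCM toric_mmap1 // mcoeffX eqxx mulr1 big_seq_cond big1 ?addr0.
  by move/eqP; rewrite mcoeff_eq0 uf.
move=> v /andP[vf ne]; rewrite mcoeffCM.
have [[i iD vi]|vD] := dependent_support v.
  by rewrite (toric_mmap1_dep iD vi) mcoeff0 mulr0.
rewrite toric_mmap1 // mcoeffX; case: eqP => [e|_]; last by rewrite mulr0.
case/eqP: ne; case: tle_term_order => _ anti _ _ _; apply: anti; rewrite fu //=.
apply: tle_min => // [j|d|b].
- by rewrite -!margins_s e.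
- by rewrite -!margins_t e.
- by rewrite -!margins_y e.
Qed.

End Toric.

(** * Words and the linear shape of the model *)

Section Slope.
Variables (A : zmodType) (m : nat).

(* The difference of the rows a and 0 of a matrix with constant row sums is determined
   by its entries off the row and the column 0. *)
Definition slope (t : 'I_m -> 'I_m -> A) (a b : 'I_m.+1) : A :=
  if unlift ord0 a is Some a' then
    if unlift ord0 b is Some b' then t a' b' else - \sum_b' t a' b'
  else 0.

Lemma slope0 t b : slope t ord0 b = 0.
Proof. by rewrite /slope unlift_none. Qed.

Lemma slope_lift t a b : slope t (lift ord0 a) (lift ord0 b) = t a b.
Proof. by rewrite /slope !liftK. Qed.

Lemma slope_lift0 t a : slope t (lift ord0 a) ord0 = - \sum_b t a b.
Proof. by rewrite /slope liftK unlift_none. Qed.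

Lemma sum_slope t a : \sum_b slope t a b = 0.
Proof.
rewrite big_ord_recl; case: (unliftP ord0 a) => [a' ->|->]; last first.
  by rewrite slope0 add0r big1 // => b _; rewrite slope0.
by rewrite slope_lift0 (eq_bigr _ (fun b _ => slope_lift t a' b)) addNr.
Qed.

Lemma eq_slope t t' a b : (forall a b, t a b = t' a b) -> slope t a b = slope t' a b.
Proof.
move=> e; rewrite /slope; case: (unlift _ a) => // a'; case: (unlift _ b) => [b'|] //.
by congr (- _); apply: eq_bigr.
Qed.

Variable l : nat.

(* Shape of the points of the linear span of the model: [Z b] is the coordinate at
   0...0b and [X j a b] its increment when the entry 0 at position j becomes a. *)
Definition mtd_form (Z : 'I_m.+1 -> A) (X : 'I_l -> 'I_m -> 'I_m -> A)
    (w : mtd_word l m.+1) : A :=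
  Z (tnth w ord_max)
  + \sum_j slope (X j) (tnth w (widen_ord (leqnSn l) j)) (tnth w ord_max).

Lemma eq_mtd_form Z X Z' X' w : (forall b, Z b = Z' b) ->
  (forall j a b, X j a b = X' j a b) -> mtd_form Z X w = mtd_form Z' X' w.
Proof.
move=> eZ eX; rewrite /mtd_form eZ; congr (_ + _); apply: eq_bigr => j _.
exact: eq_slope.
Qed.

Definition vertex_word (b : 'I_m.+1) : mtd_word l m.+1 :=
  [tuple if i == ord_max then b else ord0 | i < l.+1].

Definition entry_word (j : 'I_l) (a b : 'I_m) : mtd_word l m.+1 :=
  [tuple if i == ord_max then lift ord0 b else
         if i == widen_ord (leqnSn l) j then lift ord0 a else ord0 | i < l.+1].

Lemma widen_neq_max (j : 'I_l) : (widen_ord (leqnSn l) j == ord_max) = false.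
Proof. by rewrite widen_lift_max eq_sym (negbTE (neq_lift _ _)). Qed.

Lemma vertex_word_last b : tnth (vertex_word b) ord_max = b.
Proof. by rewrite tnth_mktuple eqxx. Qed.

Lemma vertex_word_init b j : tnth (vertex_word b) (widen_ord (leqnSn l) j) = ord0.
Proof. by rewrite tnth_mktuple widen_neq_max. Qed.

Lemma entry_word_last j a b : tnth (entry_word j a b) ord_max = lift ord0 b.
Proof. by rewrite tnth_mktuple eqxx. Qed.

Lemma entry_word_init j a b j' :
  tnth (entry_word j a b) (widen_ord (leqnSn l) j') = if j' == j then lift ord0 a else ord0.
Proof.
rewrite tnth_mktuple widen_neq_max !widen_lift_max.
by rewrite (inj_eq (@lift_inj _ _)).
Qed.

Lemma mtd_form_vertex Z X b : mtd_form Z X (vertex_word b) = Z b.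
Proof.
rewrite /mtd_form vertex_word_last big1 ?addr0 // => j _.
by rewrite vertex_word_init slope0.
Qed.

Lemma mtd_form_entry Z X j a b :
  mtd_form Z X (entry_word j a b) = Z (lift ord0 b) + X j a b.
Proof.
rewrite /mtd_form entry_word_last (bigD1 j) //= entry_word_init eqxx slope_lift.
by rewrite big1 ?addr0 // => j' /negbTE ne; rewrite entry_word_init ne slope0.
Qed.

Lemma vertex_word_inj : injective vertex_word.
Proof. by move=> b b' e; rewrite -(vertex_word_last b) e vertex_word_last. Qed.

Lemma entry_word_inj j a b j' a' b' :
  entry_word j a b = entry_word j' a' b' -> [/\ j = j', a = a' & b = b'].
Proof.
move=> e; have := congr1 (fun w : mtd_word l m.+1 => tnth w ord_max) e.
rewrite !entry_word_last => /lift_inj ->.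
have := congr1 (fun w : mtd_word l m.+1 => tnth w (widen_ord (leqnSn l) j)) e.
rewrite !entry_word_init eqxx; case: eqP => [->|_ /eqP]; first by move/lift_inj->.
by rewrite eq_sym (negbTE (neq_lift _ _)).
Qed.

Lemma entry_vertex_word j a b b' : entry_word j a b <> vertex_word b'.
Proof.
move=> e; have := congr1 (fun w : mtd_word l m.+1 => tnth w (widen_ord (leqnSn l) j)) e.
rewrite entry_word_init vertex_word_init eqxx => /eqP.
by rewrite eq_sym (negbTE (neq_lift _ _)).
Qed.

End Slope.

Lemma raddf_slope (A B : zmodType) (m : nat) (f : {additive A -> B}) t (a b : 'I_m.+1) :
  f (slope t a b) = slope (fun a b => f (t a b)) a b.
Proof.
rewrite /slope; case: (unlift _ a) => [a'|]; last by rewrite raddf0.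
by case: (unlift _ b) => [b'|] //; rewrite raddfN raddf_sum.
Qed.

Lemma raddf_mtd_form (A B : zmodType) (m l : nat) (f : {additive A -> B}) Z X
    (w : mtd_word l m.+1) :
  f (mtd_form Z X w) = mtd_form (fun b => f (Z b)) (fun j a b => f (X j a b)) w.
Proof.
rewrite /mtd_form raddfD raddf_sum; congr (_ + _); apply: eq_bigr => j _.
exact: raddf_slope.
Qed.

Lemma mtd_form_mull (A : nzRingType) (m l : nat) (c : A) Z X (w : mtd_word l m.+1) :
  c * mtd_form Z X w = mtd_form (fun b => c * Z b) (fun j a b => c * X j a b) w.
Proof. exact: (raddf_mtd_form (GRing.mull_fun c idfun)). Qed.

Lemma mul_slope (A : nzRingType) (m : nat) (c : A) t (a b : 'I_m.+1) :
  c * slope t a b = slope (fun a b => c * t a b) a b.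
Proof. exact: (raddf_slope (GRing.mull_fun c idfun)). Qed.

Lemma slope_stochastic (A : nzRingType) (m : nat) (q : 'M[A]_m.+1) a b :
  (forall a, \sum_b q a b = 1) ->
  q a b - q ord0 b =
  slope (fun a b => q (lift ord0 a) (lift ord0 b) - q ord0 (lift ord0 b)) a b.
Proof.
move=> q1; case: (unliftP ord0 a) => [a' ->|->]; last by rewrite slope0 subrr.
case: (unliftP ord0 b) => [b' ->|->]; first by rewrite slope_lift.
rewrite slope_lift0 sumrB opprB.
have := q1 (lift ord0 a'); have := q1 ord0; rewrite !big_ord_recl.
by move=> /(canRL (addrK _)) -> /(canRL (addrK _)) ->; rewrite opprB addrC addrA subrK.
Qed.

(** As [lambda] sums to 1, the entry of row 0 can be distributed over the sum on [j]; what remains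
    is [lambda_j] times a row difference of [q], a rank one family. *)
Lemma mtd_map_form (R : realType) (l m : nat) (q : 'M[R]_m.+1) (lambda : 'rV[R]_l) i :
  (forall a, \sum_b q a b = 1) -> \sum_j lambda 0 j = 1 ->
  mtd_map q lambda 0 i =
  mtd_form (fun b => (m.+1%:R ^+ l)^-1 * q ord0 b)
    (fun j a b => (m.+1%:R ^+ l)^-1 *
       (lambda 0 j * (q (lift ord0 a) (lift ord0 b) - q ord0 (lift ord0 b))))
    (enum_val i).
Proof.
move=> q1 lam1; rewrite mxE -mtd_form_mull; congr (_ * _).
rewrite /mtd_form -[q ord0 _]mul1r -lam1 mulr_suml -big_split /=.
apply: eq_bigr => j _; rewrite -mul_slope -slope_stochastic // mulrBr addrC subrK //.
Qed.

(** * Density of the model in the parametrized cone *)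

Lemma meval_mmapC (K : comNzRingType) (n k : nat) (h : 'I_n -> {mpoly K[k]}) v f :
  (mmap (@mpolyC k K) h f).@[v] = f.@[fun i => (h i).@[v]].
Proof.
rewrite [RHS]mevalE /mmap raddf_sum; apply: eq_bigr => u _ /=.
rewrite mevalM mevalC; congr (_ * _); rewrite /mmap1 rmorph_prod.
by apply: eq_bigr => i _; rewrite rmorphXn.
Qed.

Section Parametrization.
Variables (R : realType) (l m c : nat).
Variables (col : 'I_c -> 'I_m * 'I_m) (coli : 'I_m * 'I_m -> 'I_c).
Hypotheses (colK : cancel col coli) (coliK : cancel coli col) (l_gt0 : (0 < l)%N).

Local Notation K := R[i].
Local Notation n := (mtd_nvars l m.+1).
Local Notation s_var := (@s_var l c m.+1).
Local Notation t_var := (@t_var l c m.+1).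
Local Notation y_var := (@y_var l c m.+1).

Definition param_coord (i : 'I_n) : {mpoly K[l + (c + m.+1)]} :=
  mtd_form (fun b => 'X_(y_var b)) (fun j a b => 'X_(s_var j) * 'X_(t_var (coli (a, b))))
    (enum_val i).

(** Pullback along the parametrization of the cone; its kernel turns out to be the ideal of the
    model, see [MTD_idealE]. *)
Definition param_subst (f : {mpoly K[n]}) := mmap (@mpolyC _ K) param_coord f.

Definition param_point (T : Type) (s : 'I_l -> T) (t : 'I_c -> T) (y : 'I_m.+1 -> T)
    (i : 'I_(l + (c + m.+1))) : T :=
  match split i with
  | inl j => s j
  | inr i' => match split i' with inl d => t d | inr b => y b end
  end.

Lemma param_point_s T s t y j : @param_point T s t y (s_var j) = s j.
Proof. by rewrite /param_point (unsplitK (inl j)). Qed.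

Lemma param_point_t T s t y d : @param_point T s t y (t_var d) = t d.
Proof. by rewrite /param_point (unsplitK (inr (lshift _ d))) (unsplitK (inl d)). Qed.

Lemma param_point_y T s t y b : @param_point T s t y (y_var b) = y b.
Proof. by rewrite /param_point (unsplitK (inr (rshift _ b))) (unsplitK (inr b)). Qed.

Lemma meval_param_coord (p : 'I_(l + (c + m.+1)) -> K) i :
  (param_coord i).@[p] =
  mtd_form (fun b => p (y_var b)) (fun j a b => p (s_var j) * p (t_var (coli (a, b))))
    (enum_val i).
Proof.
rewrite /param_coord raddf_mtd_form; apply: eq_mtd_form => [b|j a b]; first exact: mevalXU.
by rewrite /= mevalM !mevalXU.
Qed.

Lemma meval_param_subst (f : {mpoly K[n]}) p :
  param_subst f = 0 -> f.@[fun i => (param_coord i).@[p]] = 0.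
Proof. by move=> f0; rewrite -meval_mmapC -/(param_subst f) f0 meval0. Qed.

Lemma row_sums1 (q : 'M[R]_m.+1) :
  (forall i, prob_vec (row i q)) -> forall i, \sum_j q i j = 1.
Proof. by move=> qP i; have [_ <-] := qP i; apply: eq_bigr => j _; rewrite mxE. Qed.

Lemma MTD_vanishes (f : {mpoly K[n]}) P : param_subst f = 0 -> MTD P -> vanishes_at f P.
Proof.
move=> f0 [q [lam [/row_sums1 q1 [_ lam1] PE]]] v; rewrite PE => /vlineP[k ->].
pose e := (m.+1%:R ^+ l : R)^-1.
(* The scalar [k] of the chosen representative is absorbed into the parameters [t] and [y]. *)
pose p := param_point (fun j => (lam 0 j)%:C%C)
  (fun d => k * (e * (q (lift ord0 (col d).1) (lift ord0 (col d).2)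
                      - q ord0 (lift ord0 (col d).2)))%:C%C)
  (fun b => k * (e * q ord0 b)%:C%C).
rewrite -[RHS](meval_param_subst p f0); apply: meval_eq => i.
rewrite meval_param_coord 2!mxE.
have := mtd_map_form i q1 lam1; rewrite mxE => ->.
rewrite raddf_mtd_form mtd_form_mull; apply: eq_mtd_form => [b|j a b].
  by rewrite /p param_point_y.
by rewrite /p param_point_s param_point_t coliK /= -/e !rmorphM /=; ring.
Qed.

Lemma realC_inj : injective (fun x : R => x%:C%C).
Proof. by move=> x y []. Qed.

(** A rescaling turns these parameters into a stochastic matrix and a distribution; the lower bound
    on [y] keeps the matrix entries non-negative. *)
Lemma param_in_MTD (s : 'I_l -> R) (t : 'I_c -> R) (y : 'I_m.+1 -> R) :
  (forall j, 0 < s j <= 1) -> (forall d, 0 <= t d <= 1) ->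
  (forall b, (l * m)%:R < y b) ->
  exists2 P : pspace K n, MTD P &
    \row_i (mtd_form y (fun j a b => s j * t (coli (a, b))) (enum_val i))%:C%C \in val P.
Proof.
move=> sP tP yP; pose S := \sum_j s j; pose Y := \sum_b y b.
have s0 j : 0 < s j by case/andP: (sP j).
have y0 b : 0 < y b by apply: le_lt_trans (yP b); rewrite ler0n.
have S0 : 0 < S.
  rewrite /S (bigD1 (Ordinal l_gt0)) //= ltr_pwDl // sumr_ge0 // => j _; exact: ltW.
have Y0 : 0 < Y.
  rewrite /Y big_ord_recl ltr_pwDl // sumr_ge0 // => b _; exact: ltW.
pose T a b := t (coli (a, b)).
(* Since slopes sum to 0 along a row, dividing by [Y] gives row sums 1; the factor [S] compensates
   for the normalization of [s] in [lam]. *)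
pose q : 'M[R]_m.+1 := \matrix_(a, b) ((y b + S * slope T a b) / Y).
pose lam : 'rV[R]_l := \row_j (s j / S).
pose e := (m.+1%:R ^+ l : R)^-1.
have e0 : 0 < e by rewrite invr_gt0 exprn_gt0 // ltr0n.
pose w : 'rV[R]_n := \row_i mtd_form y (fun j a b => s j * T a b) (enum_val i).
have mapE : mtd_map q lam = (e / Y) *: w.
  apply/rowP=> i; rewrite !mxE -/e -mulrA; congr (_ * _).
  rewrite /mtd_form mulrDr mulr_sumr.
  have -> : Y^-1 * y (tnth (enum_val i) ord_max) =
      \sum_j s j * (Y^-1 * S^-1 * y (tnth (enum_val i) ord_max)).
    by rewrite -mulr_suml -/S; field; rewrite !gt_eqF.
  rewrite -big_split; apply: eq_bigr => j _; rewrite !mxE -mul_slope.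
  by rewrite /=; field; rewrite !gt_eqF.
have w0 : map_mx (fun x : R => x%:C%C) (mtd_map q lam) != 0.
  apply/eqP=> /rowP/(_ (enum_rank (vertex_word l ord0))).
  rewrite mapE !mxE enum_rankK mtd_form_vertex => /realC_inj/eqP.
  by rewrite gt_eqF // mulr_gt0 // divr_gt0.
have d1 : \dim <[map_mx (fun x : R => x%:C%C) (mtd_map q lam)]>%VS == 1%N.
  by rewrite dim_vline w0.
exists (exist (fun V : {vspace 'rV[K]_n} => \dim V == 1%N : Prop) _ d1); last first.
  apply/vlineP; exists ((Y / e)%:C)%C; apply/rowP=> i; rewrite mapE !mxE -rmorphM /=.
  by congr (_%:C)%C; field; rewrite !gt_eqF.
exists q, lam; split=> // [a|].
  split=> [b|]; last first.
    under eq_bigr do rewrite !mxE.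
    by rewrite -mulr_suml big_split /= -mulr_sumr sum_slope mulr0 addr0 divff ?gt_eqF.
  rewrite !mxE divr_ge0 ?(ltW Y0) //.
  case: (unliftP ord0 a) => [a' ->|->]; last by rewrite slope0 mulr0 addr0 ltW.
  case: (unliftP ord0 b) => [b' ->|->].
    by rewrite slope_lift addr_ge0 ?(ltW (y0 _)) // mulr_ge0 ?(ltW S0) //; case/andP: (tP (coli (a', b'))).
  (* Only column 0 carries a negative slope: there [S] is at most [l] and the sum of the [t] at most
     [m], whence the bound [l * m]. *)
  rewrite slope_lift0 mulrN subr_ge0; apply: le_trans (ltW (yP ord0)).
  rewrite natrM; apply: ler_pM; first exact: ltW.
  - by apply: sumr_ge0 => b' _; case/andP: (tP (coli (a', b'))).
  - rewrite -[l in l%:R]card_ord -sumr_const; apply: ler_sum => j _.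
    by case/andP: (sP j).
  - rewrite -[m in m%:R]card_ord -sumr_const; apply: ler_sum => b' _.
    by case/andP: (tP (coli (a', b'))).
split=> [j|]; first by rewrite mxE divr_ge0 // ltW.
by under eq_bigr do rewrite mxE; rewrite -mulr_suml divff ?gt_eqF.
Qed.

Lemma MTD_dense (f : {mpoly K[n]}) :
  (forall P, MTD P -> vanishes_at f P) -> param_subst f = 0.
Proof.
move=> fP; pose inv k : R := k.+1%:R^-1.
have inv_inj : injective inv by move=> k k' /invr_inj/eqP; rewrite eqr_nat => /eqP[].
have invP k : 0 < inv k <= 1 by rewrite invr_gt0 ltr0n invf_le1 ?ltr0n ?ler1n.
pose big k : R := (l * m + k).+1%:R.
pose g := param_point (fun _ : 'I_l => inv) (fun _ : 'I_c => inv) (fun _ : 'I_m.+1 => big).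
apply: (mpoly_grid_eq0 (s := fun i k => (g i k)%:C%C)) => [i k k' /realC_inj|k].
  rewrite /g /param_point; case: split => [j|i']; first exact: inv_inj.
  case: split => [d|b]; first exact: inv_inj.
  by rewrite /big => /eqP; rewrite eqr_nat => /eqP[] /addnI.
rewrite meval_mmapC.
have sP j : 0 < inv (k (s_var j)) <= 1 by [].
have tP d : 0 <= inv (k (t_var d)) <= 1 by rewrite ltW //=; case/andP: (invP (k (t_var d))).
have yP b : (l * m)%:R < big (k (y_var b)) by rewrite /big ltr_nat ltnS leq_addr.
have [P PM] := param_in_MTD sP tP yP.
move=> /(fP P PM) <-; apply: meval_eq => i; rewrite meval_param_coord mxE.
rewrite raddf_mtd_form; apply: eq_mtd_form => [b|j a b].
  by rewrite /= /g param_point_y.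
by rewrite /= /g param_point_s param_point_t rmorphM.
Qed.

End Parametrization.

(** * The determinantal ideal *)

Lemma mtd_form_ind (A : zmodType) (m l : nat) (Q : A -> Prop) Z X (w : mtd_word l m.+1) :
  Q 0 -> (forall f g, Q f -> Q g -> Q (f + g)) -> (forall f, Q f -> Q (- f)) ->
  (forall b, Q (Z b)) -> (forall j a b, Q (X j a b)) -> Q (mtd_form Z X w).
Proof.
move=> Q0 QD QN QZ QX.
have Qsum (J : finType) (F : J -> A) : (forall j, Q (F j)) -> Q (\sum_j F j).
  by move=> QF; apply: (big_rec Q) => // j f _; apply: QD.
apply: QD => //; apply: (Qsum) => j; rewrite /slope.
case: (unlift _ _) => // a; case: (unlift _ _) => [b|]; first exact: QX.
by apply: QN; apply: Qsum.
Qed.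

Section Presentation.
Variables (R : realType) (l m c : nat).
Variables (col : 'I_c -> 'I_m * 'I_m) (coli : 'I_m * 'I_m -> 'I_c).
Hypotheses (colK : cancel col coli) (coliK : cancel coli col) (l_gt0 : (0 < l)%N).

Local Notation K := R[i].
Local Notation n := (mtd_nvars l m.+1).
Local Notation subst f := (param_subst coli (f : {mpoly K[n]})).

Definition vertex_var (b : 'I_m.+1) : 'I_n := enum_rank (vertex_word l b).
Definition entry_var (j : 'I_l) (a b : 'I_m) : 'I_n := enum_rank (entry_word j a b).
Definition entry_col_var j d := entry_var j (col d).1 (col d).2.

Local Notation x := entry_col_var.
Local Notation z := vertex_var.

Lemma vertex_var_inj : injective z.
Proof. by move=> b b' /enum_rank_inj/vertex_word_inj. Qed.

Lemma entry_col_var_inj j d j' d' : x j d = x j' d' -> j = j' /\ d = d'.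
Proof.
move=> /enum_rank_inj/entry_word_inj[-> e1 e2]; split=> //.
apply: (can_inj colK); move: e1 e2; case: (col d) => ? ?.
by case: (col d') => /= ? ? -> ->.
Qed.

Lemma entry_vertex_var j d b : x j d <> z b.
Proof. by move=> /enum_rank_inj/entry_vertex_word. Qed.

Lemma entry_varE j a b : entry_var j a b = x j (coli (a, b)).
Proof. by rewrite /entry_col_var coliK. Qed.

Local Notation le := (tle x z).
Local Notation leO := (@tle_term_order _ _ _ _ _ _ entry_col_var_inj vertex_var_inj entry_vertex_var).

Definition entry_form j a b : {mpoly K[n]} := 'X_(entry_var j a b) - 'X_(z (lift ord0 b)).

Definition entry_mx : 'M[{mpoly K[n]}]_(l, c) :=
  \matrix_(j, d) entry_form j (col d).1 (col d).2.

(** Eliminates the coordinate of [w]; the form is zero when [w] is a vertex or an entry word. *)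
Definition span_form (w : mtd_word l m.+1) : {mpoly K[n]} :=
  'X_(enum_rank w) - mtd_form (fun b => 'X_(z b)) entry_form w.

Definition span_forms := [seq span_form w | w <- enum {: mtd_word l m.+1}].

Definition mtd_basis := span_forms ++ minors2 entry_mx.

Lemma param_substX i : subst 'X_i = param_coord R coli i.
Proof. by rewrite /param_subst mmapX mmap1U. Qed.

Lemma param_substB f g : subst (f - g) = subst f - subst g.
Proof. exact: raddfB. Qed.

Lemma param_substM f g : subst (f * g) = subst f * subst g.
Proof. exact: rmorphM. Qed.

Lemma param_subst_entry_form j a b :
  subst (entry_form j a b) = 'X_(s_var c m.+1 j) * 'X_(t_var l m.+1 (coli (a, b))).
Proof.
rewrite param_substB !param_substX /param_coord !enum_rankK mtd_form_entry mtd_form_vertex.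
by rewrite addrC addKr.
Qed.

Lemma param_subst_span_form w : subst (span_form w) = 0.
Proof.
apply/eqP; rewrite param_substB subr_eq0 param_substX /param_coord enum_rankK; apply/eqP.
rewrite /param_subst raddf_mtd_form; apply: eq_mtd_form => [b|j a b]; last first.
  by rewrite -[RHS]/(subst _) param_subst_entry_form.
by rewrite -[RHS]/(subst _) param_substX /param_coord enum_rankK mtd_form_vertex.
Qed.

Lemma minors2P (A : comNzRingType) (r r' : nat) (M : 'M[A]_(r, r')) g :
  reflect (exists (j j' : 'I_r) (d d' : 'I_r'), [/\ (j < j')%N, (d < d')%N
             & g = M j d * M j' d' - M j d' * M j' d]) (g \in minors2 M).
Proof.
apply: (iffP imageP) => [[[[j j'] [d d']] /andP[jj dd] ->]|[j [j' [d [d' [jj dd ->]]]]]].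
  by exists j, j', d, d'.
by exists ((j, j'), (d, d')) => //; rewrite inE /= jj.
Qed.

Lemma param_subst_basis g : g \in mtd_basis -> subst g = 0.
Proof.
rewrite mem_cat => /orP[/mapP[w _ ->]|/minors2P[j [j' [d [d' [_ _ ->]]]]]].
  exact: param_subst_span_form.
by rewrite param_substB !param_substM !mxE !param_subst_entry_form -!surjective_pairing !colK; ring.
Qed.

Lemma entry_form_homog j a b : entry_form j a b \is 1.-homog.
Proof. by rewrite rpredB // dhomogX /= mdeg1. Qed.

Lemma span_form_homog w : span_form w \is 1.-homog.
Proof.
rewrite rpredB ?dhomogX /= ?mdeg1 //.
apply: (@mtd_form_ind _ _ _ (fun f => f \is 1.-homog)) => [|f g|f|b|j a b].
- exact: rpred0.
- exact: rpredD.
- by rewrite rpredN.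
- by rewrite dhomogX /= mdeg1.
- exact: entry_form_homog.
Qed.

Lemma basis_homogeneous g : g \in mtd_basis -> homogeneous g.
Proof.
rewrite mem_cat => /orP[/mapP[w _ ->]|/minors2P[j [j' [d [d' [_ _ ->]]]]]].
  by exists 1%N; exact: span_form_homog.
by exists 2%N; rewrite rpredB // -[2%N]/(1 + 1)%N dhomogM // mxE entry_form_homog.
Qed.

(** The zero locus of a single homogeneous form is closed, and it contains the model. *)
Lemma closure_vanishes (f : {mpoly K[n]}) P : homogeneous f -> subst f = 0 ->
  MTD_closure P -> vanishes_at f P.
Proof.
move=> fh f0 /(_ (vanishes_at f)); apply=> [|Q]; last exact: MTD_vanishes.
by exists (eq f); split=> [_ <-//|Q]; split=> [? _ <-//|]; apply.
Qed.

Lemma MTD_sub_closure (P : pspace K n) : MTD P -> MTD_closure P.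
Proof. by move=> PM Z _; apply. Qed.

Lemma below_form i Z X (w : mtd_word l m.+1) :
  (forall b, below le U_(i)%MM (Z b)) -> (forall j a b, below le U_(i)%MM (X j a b)) ->
  below le U_(i)%MM (mtd_form Z X w : {mpoly K[n]}).
Proof.
move=> ? ?; apply: mtd_form_ind => //; [exact: below0|exact: belowD|exact: belowN].
Qed.

Lemma entry_form_lead j d :
  monic_lead le U_(x j d)%MM (entry_form j (col d).1 (col d).2).
Proof.
apply: monic_leadB; first exact: (monic_leadX K leO).
have [? ?] := tle_xz entry_col_var_inj vertex_var_inj entry_vertex_var j d (lift ord0 (col d).2).
exact: belowX.
Qed.

Lemma vertex_below i b : dependent x z i -> below le U_(i)%MM ('X_(z b) : {mpoly K[n]}).
Proof.
move=> iD.
have [? ?] := tle_dep_z entry_col_var_inj vertex_var_inj entry_vertex_var b iD.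
exact: belowX.
Qed.

Lemma entry_below i j a b :
  dependent x z i -> below le U_(i)%MM ('X_(entry_var j a b) : {mpoly K[n]}).
Proof.
move=> iD; rewrite entry_varE.
have [? ?] := tle_dep_x entry_col_var_inj vertex_var_inj entry_vertex_var j (coli (a, b)) iD.
exact: belowX.
Qed.

Lemma span_form_lead i : dependent x z i -> monic_lead le U_(i)%MM (span_form (enum_val i)).
Proof.
move=> iD; rewrite /span_form enum_valK; apply: monic_leadB; first exact: (monic_leadX K leO).
apply: below_form => [b|j a b]; first exact: vertex_below.
by apply: belowB; [exact: entry_below|exact: vertex_below].
Qed.

Lemma minor_lead (j j' : 'I_l) (d d' : 'I_c) : (j < j')%N -> (d < d')%N ->
  monic_lead le (U_(x j d) + U_(x j' d'))%MM
    (entry_mx j d * entry_mx j' d' - entry_mx j d' * entry_mx j' d).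
Proof.
move=> jj dd; rewrite !mxE; apply: monic_leadB.
  by apply: (monic_leadM leO); exact: entry_form_lead.
have [? ?] := tle_diag entry_col_var_inj vertex_var_inj entry_vertex_var jj dd.
apply: (monic_lead_below leO (u := U_(x j d') + U_(x j' d))%MM) => //.
by apply: (monic_leadM leO); exact: entry_form_lead.
Qed.

(* Unitriangular change of variables turning the parametrization into a toric one. *)
Definition straighten (i : 'I_n) : {mpoly K[n]} :=
  (if varP x z i is VarDep _ then 'X_i else 0)
  + mtd_form (fun b => 'X_(z b)) (fun j a b => 'X_(entry_var j a b)) (enum_val i).

Lemma straighten_lead i : monic_lead le U_(i)%MM (straighten i).
Proof.
rewrite /straighten; case: varP => [j d <-|b <-|iD].
- rewrite add0r enum_rankK mtd_form_entry addrC; apply: monic_leadD.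
    exact: (monic_leadX K leO).
  have [? ?] := tle_xz entry_col_var_inj vertex_var_inj entry_vertex_var j d (lift ord0 (col d).2).
  exact: belowX.
- by rewrite add0r enum_rankK mtd_form_vertex; exact: (monic_leadX K leO).
- apply: monic_leadD; first exact: (monic_leadX K leO).
  by apply: below_form => [b|j a b]; [exact: vertex_below|exact: entry_below].
Qed.

(** The toric map kills the extra summand ['X_i] of a dependent variable; the remaining form has as
    its arguments the images of the [x] and [z]. *)
Lemma toric_straighten i :
  mmap (@mpolyC _ K) (toric_point K x z) (straighten i) = param_coord R coli i.
Proof.
rewrite /straighten raddfD raddf_mtd_form /=.
have -> : mmap (@mpolyC _ K) (toric_point K x z)
    (if varP x z i is VarDep _ then 'X_i else 0) = 0.
  case: varP => [j d _|b _|iD]; rewrite ?raddf0 //.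
  by rewrite mmapX mmap1U toric_point_dep.
rewrite add0r; apply: eq_mtd_form => [b|j a b]; rewrite mmapX mmap1U.
  exact: (toric_pointZ _ vertex_var_inj entry_vertex_var).
by rewrite entry_varE (toric_pointX _ entry_col_var_inj entry_vertex_var).
Qed.

(** Straightening carries the kernel of the parametrization into that of the toric map and keeps
    leads, so [toric_lead] applies to [u]. *)
Lemma param_subst_lead_dvd (f : {mpoly K[n]}) u : subst f = 0 -> is_leading_monom le f u ->
  exists2 g, g \in mtd_basis & exists2 v, monic_lead le v g & (v <= u)%MM.
Proof.
move=> f0 /(leading_monom_mmap leO straighten_lead) fu.
have := toric_lead entry_col_var_inj vertex_var_inj entry_vertex_var fu.
case=> [|[i iD ui]|[j [j' [d [d' [jj dd uj uj']]]]]].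
- rewrite -f0 rmorph_mmap; apply: eq_bigr => v _ /=.
  by rewrite mmapC; congr (_ * _); apply: mmap1_eq => i /=; apply: toric_straighten.
- exists (span_form (enum_val i)); first by rewrite mem_cat map_f // mem_enum.
  by exists U_(i)%MM; [exact: span_form_lead|rewrite lep1mP].
- exists (entry_mx j d * entry_mx j' d' - entry_mx j d' * entry_mx j' d).
    by rewrite mem_cat; apply/orP; right; apply/minors2P; exists j, j', d, d'.
  exists (U_(x j d) + U_(x j' d'))%MM; first exact: minor_lead.
  (* The two variables lie in different rows, hence are distinct, and exponent 1 in each
     suffices. *)
  apply/mnm_lepP=> i; rewrite mnmDE !mnm1E; case: eqP => [<-|_]; last first.
    by case: eqP => [<-|//]; rewrite lt0n.
  case: eqP => [/entry_col_var_inj[e _]|_]; first by rewrite e ltnn in jj.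
  by rewrite lt0n.
Qed.

Lemma param_subst_ideal_gen (f : {mpoly K[n]}) :
  subst f = 0 -> ideal_gen (fun g => g \in mtd_basis) f.
Proof.
apply: (@ideal_gen_of_leads _ _ le leO (fun f => subst f = 0)).
- by move=> f' g f0 g0; rewrite param_substB f0 g0 subrr.
- by move=> f' g g0; rewrite param_substM g0 mulr0.
- by move=> g /param_subst_basis.
- exact: param_subst_lead_dvd.
- exact: (key_le_wf (key_inj entry_col_var_inj vertex_var_inj entry_vertex_var)).
Qed.

(** Generators of the ideal vanish on the model, hence pull back to 0 by density. Conversely a
    kernel element, possibly inhomogeneous, is a combination of basis elements, which are
    homogeneous and vanish on the closure. *)
Lemma MTD_idealE (f : {mpoly K[n]}) : MTD_ideal f <-> subst f = 0.
Proof.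
split=> [[k [b [g [gP ->]]]]|/param_subst_ideal_gen[k [b [g [gG ->]]]]].
  rewrite /param_subst raddf_sum big1 // => i _ /=; have [_ gv] := gP i.
  have g0 : subst (g i) = 0.
    by apply: (MTD_dense _ l_gt0) => P /MTD_sub_closure; apply: gv.
  by rewrite -/(subst _) param_substM g0 mulr0.
exists k, b, g; split=> // i; split; first exact/basis_homogeneous/gG.
move=> P; apply: closure_vanishes; first exact/basis_homogeneous/gG.
exact/param_subst_basis/gG.
Qed.

Lemma MTD_ideal_basis (f : {mpoly K[n]}) :
  MTD_ideal f <-> ideal_gen (fun g => g \in mtd_basis) f.
Proof.
rewrite MTD_idealE; split=> [|[k [b [g [gG ->]]]]]; first exact: param_subst_ideal_gen.
rewrite /param_subst raddf_sum big1 // => i _ /=.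
by rewrite -/(subst _) param_substM (param_subst_basis (gG i)) mulr0.
Qed.

Lemma MTD_groebner_basis : groebner_basis le (@MTD_ideal R l m.+1) mtd_basis.
Proof.
apply: groebner_basis_of_leads => [g /param_subst_basis/MTD_idealE//|f u /MTD_idealE].
exact: param_subst_lead_dvd.
Qed.

End Presentation.

(** * The linear span *)

Section LinearSpan.
Variables (R : realType) (l m c : nat).
Variables (col : 'I_c -> 'I_m * 'I_m) (coli : 'I_m * 'I_m -> 'I_c).
Hypotheses (colK : cancel col coli) (coliK : cancel coli col) (l_gt0 : (0 < l)%N).

Local Notation K := R[i].
Local Notation n := (mtd_nvars l m.+1).

(** The parametrization of the cone with the rank one condition on the matrix dropped, which makes
    it linear. *)
Definition span_point (p : 'rV[K]_m.+1 * 'M[K]_(l, c)) : 'rV[K]_n :=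
  \row_i mtd_form (fun b => p.1 0 b) (fun j a b => p.2 j (coli (a, b))) (enum_val i).

Lemma span_point_linear : linear span_point.
Proof.
move=> k p p'; apply/rowP=> i; rewrite !mxE mtd_form_mull /mtd_form /= !mxE.
rewrite addrACA -big_split; congr (_ + _); apply: eq_bigr => j _ /=.
rewrite /slope; case: (unlift _ _) => [a|]; last by rewrite addr0.
case: (unlift _ _) => [b|]; first by rewrite !mxE.
by rewrite -opprD -big_split; congr (- _); apply: eq_bigr => b _; rewrite !mxE.
Qed.

HB.instance Definition _ := GRing.isLinear.Build K _ _ _ span_point span_point_linear.

Definition mtd_span : {vspace 'rV[K]_n} := limg (linfun span_point).

Lemma span_point_vertex p b : span_point p 0 (vertex_var l b) = p.1 0 b.
Proof. by rewrite mxE enum_rankK mtd_form_vertex. Qed.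

Lemma span_point_entry p j a b :
  span_point p 0 (entry_var j a b) = p.1 0 (lift ord0 b) + p.2 j (coli (a, b)).
Proof. by rewrite mxE enum_rankK mtd_form_entry. Qed.

Lemma mem_span_point p : span_point p \in mtd_span.
Proof. by rewrite -[span_point p](lfunE span_point) memv_img ?memvf. Qed.

Lemma meval_span_form (v : 'rV[K]_n) w :
  (span_form R w).@[v 0] = v 0 (enum_rank w) -
    mtd_form (fun b => v 0 (vertex_var l b))
      (fun j a b => v 0 (entry_var j a b) - v 0 (vertex_var l (lift ord0 b))) w.
Proof.
rewrite mevalB mevalXU raddf_mtd_form; congr (_ - _).
by apply: eq_mtd_form => [b|j a b] /=; rewrite ?mevalB !mevalXU.
Qed.

Lemma mtd_spanP (v : 'rV[K]_n) :
  v \in mtd_span <-> {in span_forms R l m, forall f, f.@[v 0] = 0}.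
Proof.
split=> [/memv_imgP[p _ ->] _ /mapP[w _ ->]|v0].
  rewrite lfunE meval_span_form /= [in X in X - _]mxE enum_rankK; apply/eqP.
  rewrite subr_eq0; apply/eqP/eq_mtd_form => [b|j a b]; first by rewrite span_point_vertex.
  by rewrite span_point_entry span_point_vertex addrC addKr.
(* The parameters are read off at the vertex and entry words. *)
pose p : 'rV[K]_m.+1 * 'M[K]_(l, c) := (\row_b v 0 (vertex_var l b),
  \matrix_(j, d) (v 0 (entry_var j (col d).1 (col d).2) - v 0 (vertex_var l (lift ord0 (col d).2)))).
suff -> : v = span_point p by exact: mem_span_point.
apply/rowP=> i; have /eqP := v0 _ (map_f (@span_form R l m) (mem_enum _ (enum_val i))).
rewrite meval_span_form subr_eq0 enum_valK => /eqP ->; rewrite mxE.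
by apply: eq_mtd_form => [b|j a b]; rewrite mxE ?coliK.
Qed.

Lemma dim_mtd_span : \dim mtd_span = (m.+1 + l * c)%N.
Proof.
have /lker0P/eqP ker0 : injective (linfun span_point).
  move=> p p'; rewrite !lfunE /= => e.
  have e1 b : p.1 0 b = p'.1 0 b by rewrite -!span_point_vertex e.
  case: p p' e e1 => [Z X] [Z' X'] e e1; congr (_, _); first exact/rowP.
  apply/matrixP=> j d; have := congr1 (fun v : 'rV_n => v 0 (entry_var j (col d).1 (col d).2)) e.
  by rewrite /= !span_point_entry e1 => /addrI /=; rewrite -surjective_pairing colK.
have := limg_ker_dim (linfun span_point) fullv; rewrite ker0 capv0 dimv0 add0n dimvf => dE.
by rewrite /mtd_span dE -[LHS]/(1 * m.+1 + l * c)%N mul1n.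
Qed.

Lemma is_linear_span_mtd : is_linear_span (@MTD_closure R l m.+1) mtd_span.
Proof.
split=> [P PM|W' MW'].
  apply/subvP=> v vP; apply/mtd_spanP => f /mapP[w _ ->].
  apply: (closure_vanishes coliK) PM _ vP; first by exists 1%N; exact: span_form_homog.
  exact: param_subst_span_form.
(* A form vanishing on the model vanishes on the whole parametrized cone, which contains
   a basis of [mtd_span]; apply this to the coordinates of a projection with kernel W'. *)
pose g i : {mpoly K[n]} := \sum_k ((delta_mx 0 k - projv W' (delta_mx 0 k)) 0 i) *: 'X_k.
have gE i (v : 'rV[K]_n) : (g i).@[v 0] = (v - projv W' v) 0 i.
  rewrite /g raddf_sum {2 3}[v]row_sum_delta linear_sum -sumrB summxE.
  apply: eq_bigr => k _; rewrite /= mevalZ mevalXU linearZ -scalerBr !mxE.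
  by rewrite mulrC.
have g0 i : param_subst coli (g i) = 0.
  apply: (MTD_dense _ l_gt0) => P PM v vP; rewrite gE.
  have /subvP/(_ v vP) vW := MW' P (MTD_sub_closure PM).
  by rewrite projv_id // subrr mxE.
have cone s t y : \row_i mtd_form y (fun j a b => s j * t (coli (a, b))) (enum_val i) \in W'.
  set v := \row_i _; suff -> : v = projv W' v by exact: memv_proj.
  apply/eqP; rewrite -subr_eq0; apply/eqP/rowP=> i; rewrite -gE mxE.
  rewrite -[RHS](meval_param_subst (param_point s t y) (g0 i)); apply: meval_eq => k.
  rewrite meval_param_coord mxE; apply: eq_mtd_form => [b|j a b].
    by rewrite param_point_y.
  by rewrite param_point_s param_point_t.
apply/subvP=> _ /memv_imgP[[Z X] _ ->]; rewrite lfunE /=.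
(* The zero matrix and the multiples of matrix units have rank at most one, so [(Z, 0)] and each
   entry of [X] give points of the cone, and these add up to the given point. *)
have -> : (Z, X) = (Z, 0) + (0, X) by congr pair; rewrite ?addr0 ?add0r.
have pairD : {morph (fun Y : 'M[K]_(l, c) => (0 : 'rV[K]_m.+1, Y)) : Y Y' / Y + Y'}.
  by move=> Y Y'; congr pair; rewrite addr0.
have coneE Z' (s : 'I_l -> K) (t : 'I_c -> K) : span_point (Z', \matrix_(j, d) (s j * t d)) \in W'.
  suff -> : span_point (Z', \matrix_(j, d) (s j * t d))
      = \row_i mtd_form (Z' 0) (fun j a b => s j * t (coli (a, b))) (enum_val i) by exact: cone.
  by apply/rowP=> i; rewrite !mxE; apply: eq_mtd_form => // j a b; rewrite mxE.
rewrite linearD [X in (0, X)]matrix_sum_delta rpredD //.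
  suff <- : \matrix_(j, d) (0 * 0) = 0 :> 'M[K]_(l, c).
    exact: (coneE Z (fun=> 0) (fun=> 0)).
  by apply/matrixP=> j d; rewrite !mxE mul0r.
rewrite (big_morph _ pairD (erefl _)) linear_sum rpred_sum // => j _.
rewrite (big_morph _ pairD (erefl _)) linear_sum rpred_sum // => d _.
suff <- : \matrix_(j', d') ((j' == j)%:R * (X j d * (d' == d)%:R)) = X j d *: delta_mx j d.
  exact: (coneE 0 (fun j' => (j' == j)%:R) (fun d' => X j d * (d' == d)%:R)).
apply/matrixP=> j' d'; rewrite !mxE.
by case: (j' == j); case: (d' == d); rewrite /= ?mul1r ?mul0r ?mulr0.
Qed.

End LinearSpan.

(** * Indexing of the matrix columns and the dimension count *)

Theorem theorem8 (R : realType) (l m : nat) (hl : (0 < l)%N) (hm : (0 < m)%N) :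
  exists W : {vspace 'rV[R[i]]_(mtd_nvars l m)},
    [/\ is_linear_span (@MTD_closure R l m) W,
        \dim W = ((m - 1) * (l * m - l + 1)).+1,
        exists (L : seq {mpoly R[i][mtd_nvars l m]})
               (A : 'M[{mpoly R[i][mtd_nvars l m]}]_(l, (m - 1) ^ 2)),
          determinantal_presentation W (@MTD_ideal R l m) L A
      & exists (L : seq {mpoly R[i][mtd_nvars l m]})
               (A : 'M[{mpoly R[i][mtd_nvars l m]}]_(l, (m - 1) ^ 2))
               (le : rel 'X_{1..mtd_nvars l m}),
          [/\ determinantal_presentation W (@MTD_ideal R l m) L A,
              term_order le
            & groebner_basis le (@MTD_ideal R l m) (L ++ minors2 A)]].
Proof.
(* From here on [m] counts the nonzero states, and there are [m.+1] states in all. *)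
case: m hm => // m _.
have cE : ((m.+1 - 1) ^ 2 = #|{: 'I_m * 'I_m}|)%N by rewrite card_prod card_ord subn1.
pose col (d : 'I_((m.+1 - 1) ^ 2)) : 'I_m * 'I_m := enum_val (cast_ord cE d).
pose coli (p : 'I_m * 'I_m) := cast_ord (esym cE) (enum_rank p).
have colK : cancel col coli by move=> d; rewrite /coli enum_valK cast_ordK.
have coliK : cancel coli col by move=> p; rewrite /col cast_ordKV enum_rankK.
have pres : determinantal_presentation (mtd_span R l coli) (@MTD_ideal R l m.+1)
    (span_forms R l m) (entry_mx R l col).
  split=> [_ /mapP[w _ ->]|v|j d|f].
  - exact: span_form_homog.
  - exact: mtd_spanP coliK v.
  - by rewrite mxE entry_form_homog.
  - exact: MTD_ideal_basis colK coliK hl f.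
exists (mtd_span R l coli); split.
- exact: is_linear_span_mtd coliK hl.
(* Both sides equal [l * m ^ 2 + m + 1], one more than the projective dimension. *)
- rewrite (dim_mtd_span R l colK) subn1 /= mulnS [(l + _)%N]addnC addnK.
  by rewrite mulnDr muln1 mulnCA -mulnn addnC addnS.
- by exists (span_forms R l m), (entry_mx R l col).
exists (span_forms R l m), (entry_mx R l col), (tle (entry_col_var col) (vertex_var l (m:=m))).
split=> //; last exact: MTD_groebner_basis colK coliK hl.
apply: tle_term_order; first exact: entry_col_var_inj colK.
  exact: vertex_var_inj.
exact: entry_vertex_var.
Qed.
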